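(* There exists a universal constant $c>0$ such that for all integers $n\ge2$, $d\ge1$ and all $\lambda>0$, $\zeta\ge0$, in the partial observation model of the context with Gaussian noise of variance $\zeta^2$, $$\inf_{\hat\pi}\ \sup_{\pi^*\in\Pi_n}\ \sup_{M:\,M_{\pi^{*-1}}\in\mathbb C_{\mathrm{BISO}}}\mathbb E_{(\pi^*,M)}\big[\|M_{\hat\pi^{-1}}-M_{\pi^{*-1}}\|_F^2\big]\ \ge\ c\,\min\Big\{\mathcal R_F\big(n,d,\zeta/\sqrt\lambda\big)+\frac n\lambda e^{-2\lambda},\ nd\Big\},$$ where the infimum is over all estimators $\hat\pi$ with values in $\Pi_n$.
   Context: Partial observation model: one observes $N\sim\mathrm{Poisson}(\lambda nd)$ pairs $(x_t,y_t)$, $t=1,\dots,N$, where, given $N$, the positions $x_t$ are i.i.d. uniform on $[n]\times[d]$ and, given the positions, the $y_t$ are independent with $y_t\sim\mathcal N(M_{x_t},\zeta^2)$ (so $y_t=M_{x_t}$ if $\zeta=0$). $\Pi_n$ is the set of permutations of $[n]$. $\mathbb C_{\mathrm{BISO}}$ is the set of $B\in[0,1]^{n\times d}$ with $B_{i,j}\le B_{i+1,j}$ and $B_{i,j}\le B_{i,j+1}$. $(M_{\pi^{-1}})_{i,j}=M_{\pi^{-1}(i),j}$. With $a\wedge b=\min(a,b)$, for $\zeta>0$, $$\mathcal R_F(n,d,\zeta)=\zeta^2\left[\left(\frac{nd^{1/6}}{\zeta^{1/3}}\wedge\frac{n^{3/4}d^{1/4}}{\zeta^{1/2}}\wedge n\sqrt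 d\wedge\frac{n^{2/3}\sqrt d}{\zeta^{1/3}}\right)+n\right],$$ and $\mathcal R_F(n,d,0)=0$ (the limit as $\zeta\to0$). *)

(* Defs.v *)
From HB Require Import structures.
From mathcomp Require Import all_boot all_order all_fingroup all_algebra.
From mathcomp Require Import all_classical all_reals all_analysis.
Set Implicit Arguments.
Unset Strict Implicit.
Unset Printing Implicit Defensive.
Import Order.TTheory GRing.Theory Num.Theory.
Import numFieldNormedType.Exports.
Local Open Scope classical_set_scope.
Local Open Scope ring_scope.

Section ProductLaw.
Context d (T : measurableType d) (R : realType).

Definition cons_tuple k (u : T * k.-tuple T) : k.+1.-tuple T :=
  [tuple of u.1 :: u.2].

Lemma measurable_cons_tuple k :
  measurable_fun [set: T * k.-tuple T] (@cons_tuple k).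
Proof. by apply: measurable_cons; [exact: measurable_fst|exact: measurable_snd]. Qed.

HB.instance Definition _ k := isMeasurableFun.Build _ _ _ _
  (@cons_tuple k) (@measurable_cons_tuple k).

(* [product_law P] is the joint law of independent coordinates, the i-th having
   law [P i]: the product measure of the [P i], transported from nested pairs
   to k.-tuple T (see [product_law_box]). *)
Fixpoint product_law k : ('I_k -> probability T R) -> probability (k.-tuple T) R :=
  match k with
  | 0 => fun _ => dirac [tuple]
  | k'.+1 => fun P =>
      distribution
        (P ord0 \x product_law (fun i => P (lift ord0 i)))%E
        (@cons_tuple k')
  end.

Lemma product_law_box k (P : 'I_k -> probability T R) (A : 'I_k -> set T) :
  (forall i, measurable (A i)) ->
  product_law P [set t | forall i, A i (tnth t i)] = (\prod_i P i (A i))%E.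
Proof.
elim: k P A => [|k IH] P A mA /=.
  rewrite big_ord0 /dirac/= indicE mem_set//.
  by case.
rewrite big_ord_recl -(IH (fun i => P (lift ord0 i)) (fun i => A (lift ord0 i)))//.
rewrite -product_measure1E//; last first.
  rewrite (_ : [set _ | _] = \big[setI/setT]_(i < k)
     ((fun t : k.-tuple T => tnth t i) @^-1` A (lift ord0 i))).
    apply: bigsetI_measurable => i _; rewrite -[X in measurable X]setTI.
    exact: measurable_tnth.
  apply/seteqP; split => t /=.
    by move=> h; elim/big_ind : _ => //= B C tB tC; split.
  by rewrite -bigcap_seq => h i; apply: h; rewrite /= mem_index_enum.
rewrite /distribution /pushforward/=; congr (_ _); apply/seteqP; split => -[x t] /=.
  move=> h; split => [|i]; first by have := h ord0; rewrite tnth0.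
  by have := h (lift ord0 i); rewrite tnthS.
by case=> h0 h i; case: (unliftP ord0 i) => [j|] ->; rewrite ?tnthS ?tnth0//.
Qed.

End ProductLaw.

Section PartialObservation.
Context (R : realType).

(* [normal_prob m 0] is a junk value of the library (uniform on [0, 1]), so the
   degenerate Gaussian has to be given separately. *)
Definition gauss_law (m s : R) : probability (measurableTypeR R) R :=
  if s == 0 then \d_(m : measurableTypeR R) : probability _ _
  else normal_prob m s : probability _ _.

Definition biso n d (B : 'M[R]_(n, d)) : Prop :=
  [/\ forall i j, 0 <= B i j <= 1,
      forall (i i' : 'I_n) (j : 'I_d), i' = i.+1 :> nat -> B i j <= B i' j &
      forall (i : 'I_n) (j j' : 'I_d), j' = j.+1 :> nat -> B i j <= B i j'].

Definition frobenius2 n d (A : 'M[R]_(n, d)) : R := \sum_i \sum_j A i j ^+ 2.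

(* The matrix M_{s^{-1}}, with entries M (s^-1 i) j. *)
Definition relabel n d (s : 'S_n) (M : 'M[R]_(n, d)) : 'M[R]_(n, d) :=
  row_perm s^-1%g M.

(* An estimator returns a permutation from the number N of observations, the
   positions x_1, ..., x_N and the values y_1, ..., y_N. *)
Definition estimator_fun n d :=
  forall N : nat, N.-tuple ('I_n * 'I_d) -> N.-tuple (measurableTypeR R) -> 'S_n.

(* N and the positions are discrete, so measurability with respect to the whole
   sample amounts to measurability in the values y for each N and x. *)
Definition is_estimator n d (est : estimator_fun n d) : Prop :=
  forall N (x : N.-tuple ('I_n * 'I_d)) (s : 'S_n),
    measurable [set y | est N x y = s].

(* Expectation, under the signal matrix M, of a function of the sample:
   N ~ Poisson(lam n d); given N, the positions are i.i.d. uniform; given N and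
   the positions, the values are independent, y_t ~ N(M_{x_t}, zeta^2).
   The second argument of [poisson_prob] is a phantom. *)
Definition sample_expectation n d (lam zeta : R) (M : 'M[R]_(n, d))
    (f : forall N, N.-tuple ('I_n * 'I_d) -> N.-tuple (measurableTypeR R) -> R)
    : \bar R :=
  (\int[poisson_prob (lam * n%:R * d%:R) 0]_N
     \sum_(x : N.-tuple ('I_n * 'I_d))
       (\prod_(t < N) ((n * d)%:R)^-1)%R%:E *
       \int[product_law (fun t : 'I_N =>
              gauss_law (M (tnth x t).1 (tnth x t).2) zeta)]_y (f N x y)%:E)%E.

Definition risk n d (lam zeta : R) (est : estimator_fun n d)
    (s : 'S_n) (M : 'M[R]_(n, d)) : \bar R :=
  sample_expectation lam zeta M
    (fun N x y => frobenius2 (relabel (est N x y) M - relabel s M)).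

Definition minimax_risk n d (lam zeta : R) : \bar R :=
  ereal_inf [set r | exists2 est : estimator_fun n d, is_estimator est &
    r = ereal_sup [set risk lam zeta est sM.1 sM.2 |
          sM in [set sM : 'S_n * 'M[R]_(n, d) | biso (relabel sM.1 sM.2)]]].

Definition RF (n d : nat) (zeta : R) : R :=
  let n' : R := n%:R in let d' : R := d%:R in
  if zeta == 0 then 0 else
  zeta ^+ 2 *
  (Num.min (n' * d' `^ (1 / 6) / zeta `^ (1 / 3))
  (Num.min (n' `^ (3 / 4) * d' `^ (1 / 4) / zeta `^ (1 / 2))
  (Num.min (n' * Num.sqrt d')
           (n' `^ (2 / 3) * Num.sqrt d' / zeta `^ (1 / 3)))) + n').

End PartialObservation.

(* Main.v *)
(* The lower bound comes from random staircases. Split the rows into [G] groups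
   of [2m] and the columns into [Q] blocks of [q]; the entry of a cell is [h]
   times the sum of its group and block indices, plus another [h] on the upper
   half of the group when the cell is switched on, independently for each cell
   with probability [th]. All these matrices are bi-isotonic. After a uniform
   permutation of the rows, exchanging a row with its partner in the other half
   of the group turns the estimation of the permutation into one test per pair
   of rows, every error costing [h^2] for each switched-on column.

   The tests cannot succeed for two reasons. With probability at least
   [exp (- 2 lam q Q)] the two rows are not observed at all: this gives the term
   [n / lam exp (- 2 lam)]. Otherwise, the other rows of the group reveal too
   little about the switches: conditionally on them, the chi-square distance
   between the laws of the observations of one row and pure noise is of order
   [(h^2 / z^2) q \sum_b p_b^2], where [z^2 = zeta^2 / lam] and [p_b] is the
   posterior probability that cell [b] is switched on. With [th = 1] and a
   single cell this gives the term [z^2 n], and with [h^2 ~ z^2 / (m q)] and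
   [th ~ sqrt (m q / d)] the remaining one, after optimizing over [m] and [q]. *)
Require Import Defs.
From mathcomp Require Import all_boot all_order all_fingroup all_algebra.
From mathcomp Require Import all_classical all_reals all_analysis.
From mathcomp Require Import measurable_realfun zify ring lra.
Import Order.TTheory GRing.Theory Num.Theory.
Import numFieldNormedType.Exports.
Set Implicit Arguments.
Unset Strict Implicit.
Unset Printing Implicit Defensive.
Local Open Scope classical_set_scope.
Local Open Scope ring_scope.

(** * Likelihood ratios of Gaussian samples *)

Section Gauss.
Context (R : realType).
Implicit Types (m a s y : R).

Lemma ge0_integral_normal_prob m s (f : _ -> \bar R) :
  measurable_fun setT f -> (forall y, 0 <= f y)%E ->
  (\int[normal_prob m s]_y f y =
   \int[@lebesgue_measure R]_y (f y * (normal_pdf m s y)%:E))%E.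
Proof.
move=> mf f0.
have dom := @normal_prob_dominates R m s.
have mp : measurable_fun setT (fun y : measurableTypeR R => (normal_pdf m s y)%:E).
  by apply/measurable_EFinP; exact: measurable_normal_pdf.
rewrite -(Radon_Nikodym_SigmaFinite.change_of_variables dom f0)//.
apply: ge0_ae_eq_integral => //.
- apply: emeasurable_funM => //.
  exact: (measurable_int _ (Radon_Nikodym_SigmaFinite.f_integrable dom)).
- exact: emeasurable_funM.
- by move=> y _; rewrite mule_ge0// Radon_Nikodym_SigmaFinite.f_ge0.
- by move=> y _; rewrite mule_ge0// lee_fin normal_pdf_ge0.
- apply: ae_eqe_mul2l; apply: integral_ae_eq => //.
    exact: Radon_Nikodym_SigmaFinite.f_integrable.
  by move=> A _ mA; rewrite -(Radon_Nikodym_SigmaFinite.f_integral dom)//.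
Qed.

Definition gauss_lr s m a y := expR ((y - m) * a / s ^+ 2 - a ^+ 2 / (s ^+ 2 *+ 2)).

Lemma measurable_gauss_lr s m a : measurable_fun setT (gauss_lr s m a : measurableTypeR R -> R).
Proof.
apply: measurableT_comp => //=; apply: measurable_funB => //.
by do 2 apply: measurable_funM => //; exact: measurable_funB.
Qed.

Lemma gauss_lr_gt0 s m a y : 0 < gauss_lr s m a y.
Proof. exact: expR_gt0. Qed.

Lemma gauss_lr0 s m y : gauss_lr s m 0 y = 1.
Proof. by rewrite /gauss_lr mulr0 expr0n !mul0r subrr expR0. Qed.

Lemma integral_gauss_shift s m a (f : measurableTypeR R -> \bar R) : s != 0 ->
  measurable_fun setT f -> (forall y, 0 <= f y)%E ->
  (\int[gauss_law (m + a) s]_y f y =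
   \int[gauss_law m s]_y (f y * (gauss_lr s m a y)%:E))%E.
Proof.
move=> s0 mf f0; rewrite /gauss_law (negbTE s0).
apply: etrans; first exact: (ge0_integral_normal_prob (m + a) s mf f0).
apply/esym; apply: etrans; first apply: ge0_integral_normal_prob.
- apply: emeasurable_funM; first exact: mf.
  by apply/measurable_EFinP; exact: measurable_gauss_lr.
- by move=> y; apply: mule_ge0; [exact: f0|rewrite lee_fin; exact/ltW/gauss_lr_gt0].
apply: eq_integral => y _; rewrite -muleA -EFinM; congr (_ * _%:E)%E.
rewrite !normal_pdfE//= mulrCA; congr *%R.
rewrite /normal_fun /gauss_lr -expRD; congr expR.
by field.
Qed.

End Gauss.

Section Product.
Context (R : realType).
Local Notation T := (measurableTypeR R).

Lemma integral_product_law k (P : 'I_k.+1 -> probability T R)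
    (f : k.+1.-tuple T -> \bar R) :
  measurable_fun setT f -> (forall t, 0 <= f t)%E ->
  (\int[product_law P]_t f t =
   \int[P ord0]_x \int[product_law (fun i => P (lift ord0 i))]_t
     f (Defs.cons_tuple (x, t)))%E.
Proof.
move=> mf f0 /=; rewrite ge0_integral_distribution//.
rewrite fubini_tonelli1//; last by move=> x /=; exact: f0.
by apply: measurableT_comp => //; exact: measurable_cons_tuple.
Qed.

Lemma measurable_cons_tuple2 k (x : T) :
  measurable_fun setT (fun t : k.-tuple T => Defs.cons_tuple (x, t)).
Proof.
apply: (measurableT_comp (@measurable_cons_tuple _ T k)).
by apply: measurable_fun_pair; [exact: measurable_cst|exact: measurable_id].
Qed.

Lemma product_law_indep k (P P' : 'I_k -> probability T R) (D : pred 'I_k)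
    (f : k.-tuple T -> \bar R) :
  measurable_fun setT f -> (forall t, 0 <= f t)%E ->
  (forall i, ~~ D i -> P i = P' i) ->
  (forall y y', (forall i, ~~ D i -> tnth y i = tnth y' i) -> f y = f y') ->
  (\int[product_law P]_t f t = \int[product_law P']_t f t)%E.
Proof.
elim: k P P' D f => [|k IH] P P' D f mf f0 PP' fD.
  by congr (integral _ _ _); rewrite /product_law.
rewrite !integral_product_law//.
have inner x : (\int[product_law (fun i => P (lift ord0 i))]_t f (Defs.cons_tuple (x, t)) =
    \int[product_law (fun i => P' (lift ord0 i))]_t f (Defs.cons_tuple (x, t)))%E.
  apply: (IH _ _ (fun i => D (lift ord0 i))) => //.
  - by apply: measurableT_comp => //; exact: measurable_cons_tuple2.
  - by move=> i; exact: PP'.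
  - move=> y y' yy'; apply: fD => i; case: (unliftP ord0 i) => [j|] -> Di.
      by rewrite !tnthS; exact: yy'.
    by rewrite !tnth0.
under eq_integral do rewrite inner.
have [D0|D0] := boolP (D ord0); last by rewrite PP'.
pose c := (\int[product_law (fun i => P' (lift ord0 i))]_t f (Defs.cons_tuple (0%R : T, t)))%E.
have cE x : (\int[product_law (fun i => P' (lift ord0 i))]_t f (Defs.cons_tuple (x, t)) = c)%E.
  apply: eq_integral => t _; apply: fD => i; case: (unliftP ord0 i) => [j|] -> Di.
    by rewrite !tnthS.
  by rewrite D0 in Di.
under eq_integral do rewrite cE.
under [RHS]eq_integral do rewrite cE.
by rewrite !integral_cst//= !probability_setT.
Qed.

Definition lr k (s : R) (mu a : 'I_k -> R) (y : k.-tuple T) : R :=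
  \prod_i gauss_lr s (mu i) (a i) (tnth y i).

Lemma lrE k s (mu a : 'I_k -> R) y :
  lr s mu a y = \prod_i gauss_lr s (mu i) (a i) (tnth y i).
Proof. by []. Qed.

Lemma measurable_lr k s (mu a : 'I_k -> R) : measurable_fun setT (lr s mu a).
Proof.
apply: measurable_prod => i _.
by apply: (measurableT_comp (measurable_gauss_lr _ _ _)); exact: measurable_tnth.
Qed.

Lemma lr_gt0 k s (mu a : 'I_k -> R) y : 0 < lr s mu a y.
Proof. by apply: prodr_gt0 => i _; exact: gauss_lr_gt0. Qed.

Lemma integral_product_shift k s (mu a : 'I_k -> R) (f : k.-tuple T -> \bar R) :
  s != 0 -> measurable_fun setT f -> (forall t, 0 <= f t)%E ->
  (\int[product_law (fun i => gauss_law (mu i + a i) s)]_y f y =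
   \int[product_law (fun i => gauss_law (mu i) s)]_y (f y * (lr s mu a y)%:E))%E.
Proof.
move=> s0; elim: k mu a f => [|k IH] mu a f mf f0.
  by apply: eq_integral => y _; rewrite /lr big_ord0 mule1.
have step : (\int[product_law (fun i => gauss_law (mu i) s)]_y (f y * (lr s mu a y)%:E) =
    \int[gauss_law (mu ord0) s]_x
      \int[product_law (fun i => gauss_law (mu (lift ord0 i)) s)]_t
        (f (Defs.cons_tuple (x, t)) * (lr s mu a (Defs.cons_tuple (x, t)))%:E))%E.
  apply: integral_product_law.
  - by apply: emeasurable_funM; [exact: mf|apply/measurable_EFinP; exact: measurable_lr].
  - by move=> y; apply: mule_ge0; [exact: f0|rewrite lee_fin; exact/ltW/lr_gt0].
apply: etrans; last exact: esym step.
apply: etrans; first exact: (integral_product_law _ mf f0).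
have mf2 x : measurable_fun setT (fun t : k.-tuple T => f (Defs.cons_tuple (x, t))).
  by apply: measurableT_comp => //; exact: measurable_cons_tuple2.
apply: etrans; first apply: integral_gauss_shift => //.
- apply: (@measurable_fun_fubini_tonelli_F _ _ _ _ _
    (product_law (fun i => gauss_law (mu (lift ord0 i) + a (lift ord0 i)) s))
    (f \o @Defs.cons_tuple _ T k)) => //.
    by apply: measurableT_comp => //; exact: measurable_cons_tuple.
  by move=> y; exact: f0.
- by move=> y; apply: integral_ge0 => t _; exact: f0.
apply: eq_integral => x _.
have IHx := IH (fun i => mu (lift ord0 i)) (fun i => a (lift ord0 i)) _ (mf2 x) (fun t => f0 _).
rewrite muleC.
have -> := congr1 (fun e => (gauss_lr s (mu ord0) (a ord0) x)%:E * e)%E IHx.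
rewrite -ge0_integralZl; last 4 first.
- exact: measurableT.
- by apply: emeasurable_funM; [exact: mf2|apply/measurable_EFinP; exact: measurable_lr].
- by move=> y _; apply: mule_ge0; [exact: f0|rewrite lee_fin; exact/ltW/lr_gt0].
- by rewrite lee_fin; exact/ltW/gauss_lr_gt0.
apply: eq_integral => y _; rewrite muleCA -EFinM; congr (_ * _%:E)%E.
rewrite /lr big_ord_recl tnth0; congr *%R.
by apply: eq_bigr => i _; rewrite tnthS.
Qed.

Lemma lr_mul k s (mu a b : 'I_k -> R) y : s != 0 ->
  lr s mu a y * lr s mu b y =
  expR (\sum_i a i * b i / s ^+ 2) * lr s mu (fun i => a i + b i) y.
Proof.
move=> s0; rewrite /lr expR_sum -!big_split /=; apply: eq_bigr => i _.
by rewrite /gauss_lr -!expRD; congr expR; field.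
Qed.

Lemma integral_lr k s (mu a : 'I_k -> R) : s != 0 ->
  (\int[product_law (fun i => gauss_law (mu i) s)]_y (lr s mu a y)%:E = 1)%E.
Proof.
move=> s0; have mc : measurable_fun setT (cst 1%E : k.-tuple T -> \bar R).
  exact: measurable_cst.
have e1 := integral_product_shift mu a s0 mc (fun=> lee01).
have e2 := integral_cst (product_law (fun i => gauss_law (mu i + a i) s)) measurableT 1%E.
rewrite mul1e in e2.
apply: etrans; last exact: (probability_setT (product_law (fun i => gauss_law (mu i + a i) s))).
apply: etrans; last exact: e2.
apply: etrans; last exact: esym e1.
by apply: eq_integral => y _; rewrite mul1e.
Qed.

End Product.

Section Poisson.
Context (R : realType).

Lemma ge0_integral_poisson (r : R) k (f : nat -> \bar R) : 0 < r ->
  (forall N, 0 <= f N)%E ->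
  (\int[poisson_prob r k]_N f N = \sum_(N <oo) (poisson_pmf r N)%:E * f N)%E.
Proof.
move=> r0 f0.
have p0 N := poisson_pmf_ge0 r N.
transitivity (\int[mseries (fun N => mscale (NngNum (p0 N)) (\d_ N)) O]_N f N)%E.
  congr (integral _ _ _); apply/funext => A /=.
  rewrite /poisson_prob r0 /mseries esum_mkcond -nneseries_esumT; last first.
    by move=> N; case: ifPn => // ?; rewrite lee_fin; exact: p0.
  apply: eq_eseriesr => N _; transitivity ((poisson_pmf r N)%:E * (\d_N A))%E => //.
  by rewrite diracE; case: ifPn => _; rewrite ?mule1 ?mule0.
rewrite ge0_integral_measure_series//.
apply: eq_eseriesr => N _; rewrite ge0_integral_mscale//=.
by rewrite integral_dirac// diracT mul1e.
Qed.

Lemma integral_poisson_pow (r z : R) k : 0 < r -> 0 <= z ->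
  (\int[poisson_prob r k]_N (z ^+ N)%:E = (expR (r * (z - 1)))%:E)%E.
Proof.
move=> r0 z0; rewrite ge0_integral_poisson//; last first.
  by move=> N; rewrite lee_fin exprn_ge0.
transitivity ((expR (- r))%:E * (expR (r * z))%:E)%E; last first.
  by rewrite -EFinM -expRD; congr (expR _)%:E; ring.
under eq_eseriesr.
  move=> N _; rewrite /poisson_pmf r0 -EFinM.
  rewrite (_ : _ * _ * _ * _ = expR (- r) * ((r * z) ^+ N / N`!%:R)); last first.
    by rewrite exprMn; ring.
  rewrite EFinM; over.
rewrite nneseriesZl/=; last first.
  by move=> N _; rewrite lee_fin divr_ge0// exprn_ge0// mulr_ge0// ltW.
congr *%E; rewrite expRE -EFin_lim; last first.
  rewrite /pseries/=; under eq_fun do rewrite mulrC.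
  exact: is_cvg_series_exp_coeff.
apply/congr_lim/funext => N/=; rewrite /pseries/= /series/= -sumEFin//.
by under eq_bigr do rewrite mulrC.
Qed.

End Poisson.

Local Opaque lr gauss_law product_law.

Section RealIntegral.
Context d (T : measurableType d) (R : realType) (mu : {measure set T -> \bar R}).
Implicit Types f g : T -> R.

Lemma measurable_funV_gt0 f : measurable_fun setT f -> (forall x, 0 < f x) ->
  measurable_fun setT (fun x => (f x)^-1).
Proof.
move=> mf f0; rewrite (_ : (fun _ => _) = fun x => expR (- ln (f x))).
  apply: measurableT_comp => //; apply: measurableT_comp => //.
  exact: measurableT_comp.
by apply/funext => x; rewrite expRN lnK// posrE.
Qed.

Lemma ge0_integral_EFinD f g : measurable_fun setT f -> measurable_fun setT g ->
  (forall x, 0 <= f x) -> (forall x, 0 <= g x) ->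
  (\int[mu]_x (f x + g x)%:E = \int[mu]_x (f x)%:E + \int[mu]_x (g x)%:E)%E.
Proof.
move=> mf mg f0 g0; rewrite -ge0_integralD//.
- by move=> x _; rewrite lee_fin.
- exact/measurable_EFinP.
- by move=> x _; rewrite lee_fin.
- exact/measurable_EFinP.
Qed.

Lemma ge0_integral_EFinZ (c : R) f : measurable_fun setT f ->
  0 <= c -> (forall x, 0 <= f x) ->
  (\int[mu]_x (c * f x)%:E = c%:E * \int[mu]_x (f x)%:E)%E.
Proof.
move=> mf c0 f0; rewrite -ge0_integralZl_EFin//.
- by move=> x _; rewrite lee_fin.
- exact/measurable_EFinP.
Qed.

Lemma ge0_integral_EFin_sum (I : Type) (r : seq I) (c : I -> R) (F : I -> T -> R) :
  (forall i, measurable_fun setT (F i)) ->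
  (forall i, 0 <= c i) -> (forall i x, 0 <= F i x) ->
  (\int[mu]_x (\sum_(i <- r) c i * F i x)%:E =
   \sum_(i <- r) (c i)%:E * \int[mu]_x (F i x)%:E)%E.
Proof.
move=> mF c0 F0; under eq_integral do rewrite -sumEFin.
rewrite ge0_integral_sum//.
- by apply: eq_bigr => i _; rewrite ge0_integral_EFinZ.
- by move=> i; apply/measurable_EFinP/measurable_funM.
- by move=> i x _; rewrite lee_fin mulr_ge0.
Qed.

Lemma ge0_le_integral_EFin f g : measurable_fun setT f -> measurable_fun setT g ->
  (forall x, 0 <= f x) -> (forall x, f x <= g x) ->
  (\int[mu]_x (f x)%:E <= \int[mu]_x (g x)%:E)%E.
Proof.
move=> mf mg f0 fg; apply: ge0_le_integral => //.
- by move=> x _; rewrite lee_fin.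
- exact/measurable_EFinP.
- exact/measurable_EFinP.
- by move=> x _; rewrite lee_fin.
Qed.

End RealIntegral.

Section BernoulliPrior.
Context (R : realType) (I : finType).

Lemma sum_ffun_bool (f : I -> bool -> R) :
  \sum_(e : {ffun I -> bool}) \prod_i f i (e i) = \prod_i (f i true + f i false).
Proof.
by rewrite -bigA_distr_bigA; apply: eq_bigr => i _; rewrite big_bool.
Qed.

Definition bernw (th : I -> R) (e : {ffun I -> bool}) : R :=
  \prod_i (if e i then th i else 1 - th i).

Lemma bernw_ge0 th e : (forall i, 0 <= th i <= 1) -> 0 <= bernw th e.
Proof.
by move=> th01; apply: prodr_ge0 => i _; case/andP: (th01 i) => h0 h1;
  case: ifP => // _; rewrite subr_ge0.
Qed.

Lemma sum_bernw_prod th (f : I -> R) :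
  \sum_e bernw th e * \prod_i (if e i then f i else 1) =
  \prod_i (1 - th i + th i * f i).
Proof.
transitivity (\sum_(e : {ffun I -> bool}) \prod_i
    ((if e i then th i else 1 - th i) * (if e i then f i else 1))).
  by apply: eq_bigr => e _; rewrite big_split.
rewrite (@sum_ffun_bool (fun i b => (if b then th i else 1 - th i) * (if b then f i else 1))).
by apply: eq_bigr => i _; rewrite mulr1 addrC.
Qed.

Lemma sum_bernw th : \sum_e bernw th e = 1.
Proof.
transitivity (\sum_e bernw th e * \prod_i (if e i then 1 else 1)).
  by apply: eq_bigr => e _; rewrite big1 ?mulr1// => i _; rewrite if_same.
rewrite (sum_bernw_prod th (fun=> 1)).
by apply: big1 => i _; rewrite mulr1 subrK.
Qed.

Lemma sum_bernw_prod2 th (f k : I -> R) :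
  \sum_e \sum_e' bernw th e * bernw th e' *
    (\prod_i (if e i then f i else 1) * \prod_i (if e' i then f i else 1) *
     \prod_i (if e i && e' i then k i else 1)) =
  \prod_i ((1 - th i + th i * f i) ^+ 2 + (k i - 1) * (th i * f i) ^+ 2).
Proof.
pose b2 i (b b' : bool) := (if b then th i else 1 - th i) * (if b' then th i else 1 - th i)
  * ((if b then f i else 1) * (if b' then f i else 1) * (if b && b' then k i else 1)).
transitivity (\sum_(e : {ffun I -> bool}) \sum_(e' : {ffun I -> bool}) \prod_i b2 i (e i) (e' i)).
  by apply: eq_bigr => e _; apply: eq_bigr => e' _; rewrite /b2 !big_split.
transitivity (\sum_(e : {ffun I -> bool}) \prod_i (b2 i (e i) true + b2 i (e i) false)).
  apply: eq_bigr => e _.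
  by rewrite (@sum_ffun_bool (fun i b' => b2 i (e i) b')).
rewrite (@sum_ffun_bool (fun i b => b2 i b true + b2 i b false)).
by apply: eq_bigr => i _; rewrite /b2 /=; ring.
Qed.

End BernoulliPrior.

Section Elementary.
Context (R : realType).

Lemma expR_le1D2 (z : R) : 0 <= z -> z <= 2^-1 -> expR z <= 1 + 2 * z.
Proof.
move=> z0 z1; have := expR_ge1Dx (- z).
rewrite expRN -[X in _ -> expR z <= X]invrK => h.
rewrite -[leLHS]invrK lef_pV2 ?posrE; [|by rewrite invr_gt0 expR_gt0|by rewrite invr_gt0; lra].
apply: le_trans h; rewrite -[leLHS]mul1r ler_pdivrMr; last lra.
by nra.
Qed.

Lemma prod_1D_le_expR (I : finType) (a : I -> R) : (forall i, 0 <= a i) ->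
  \prod_i (1 + a i) <= expR (\sum_i a i).
Proof.
move=> a0; rewrite expR_sum; apply: ler_prod => i _.
by rewrite expR_ge1Dx addr_ge0.
Qed.

End Elementary.

(** * Testing a row against a mixture *)

Lemma eq_lee (R : realType) (x y : \bar R) : x = y -> (x <= y)%E.
Proof. by move=> ->. Qed.

Lemma integral_EFin_indic d (T : measurableType d) (R : realType)
    (P : {measure set T -> \bar R}) (S : set T) : measurable S ->
  (\int[P]_y (\1_S y)%:E = P S)%E.
Proof. by move=> mS; rewrite integral_indic ?setIT. Qed.

(* An observation [t] in the cell [b = tau t] is shifted by [h] when the switch
   [b] is on. The observations in [T1] and [T2] are those of the two compared
   rows; under the first (second) hypothesis the row of [T1] ([T2]) is shifted
   and the other one is not. The remaining observations [K] are shifted under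
   both hypotheses and carry the information about the switches. *)
Section MixtureTest.
Context (R : realType) (I : finType) (N : nat).
Variables (mu : 'I_N -> R) (s h : R) (tau : 'I_N -> option I).
Hypothesis s0 : s != 0.
Local Notation T := (measurableTypeR R).
Local Notation A := (h ^+ 2 / s ^+ 2).

Definition switched (e : {ffun I -> bool}) (t : 'I_N) : bool :=
  if tau t is Some b then e b else false.

Definition shift (D : pred 'I_N) (e : {ffun I -> bool}) (t : 'I_N) : R :=
  if D t && switched e t then h else 0.

Definition block_count (D : pred 'I_N) (b : I) : nat :=
  #|[pred t | D t & tau t == Some b]|.

Let P0 : probability (N.-tuple T) R := product_law (fun t => gauss_law (mu t) s).

Local Notation LR := (lr s mu).

Lemma eq_lr (a b : 'I_N -> R) : a =1 b -> LR a = LR b.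
Proof. by move=> /funext ->. Qed.

Lemma lr_mul_disj (a b : 'I_N -> R) y : (forall t, a t * b t = 0) ->
  LR a y * LR b y = LR (fun t => a t + b t) y.
Proof.
move=> ab; rewrite lr_mul// big1 ?expR0 ?mul1r// => t _.
by rewrite ab mul0r.
Qed.

Lemma expR_switched (D : pred 'I_N) (e e' : {ffun I -> bool}) :
  expR (\sum_t shift D e t * shift D e' t / s ^+ 2) =
  \prod_b (if e b && e' b then expR (A * (block_count D b)%:R) else 1).
Proof.
rewrite expR_sum.
transitivity (\prod_t \prod_b (if [&& D t, tau t == Some b, e b & e' b] then expR A else 1)).
  apply: eq_bigr => t _; rewrite /shift /switched.
  case: (tau t) => [b|]; last first.
    by rewrite andbF mul0r mul0r expR0 big1// => b _; rewrite andbF.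
  rewrite (bigD1 b)//= eqxx big1 ?mulr1; last first.
    move=> b' b'b; rewrite (_ : (Some b == Some b') = false) ?andbF//.
    by apply/negbTE; apply: contra b'b => /eqP[->].
  case: (D t) => /=; last by rewrite mulr0 mul0r expR0.
  by case: (e b); case: (e' b); rewrite /= ?mulr0 ?mul0r ?mul0r ?expR0// -expr2.
rewrite exchange_big; apply: eq_bigr => b _ /=.
case: ifP => _; last first.
  by apply: big1 => t _; rewrite !andbF.
under eq_bigr do rewrite andbT.
rewrite -big_mkcond /= prodr_const (mulrC A) expRM_natl /block_count.
by congr (_ ^+ _); apply: eq_card => t; rewrite !inE.
Qed.

Variables (T1 T2 : pred 'I_N) (th : I -> R).
Hypothesis th01 : forall b, 0 <= th b <= 1.
Hypothesis thP : forall b, th b <= 2^-1 \/ th b = 1.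
Let K : pred 'I_N := fun t => ~~ (T1 t || T2 t).

(* [F] is the likelihood ratio of the observations in [K], [hat b] the posterior
   probability of the switch [b] given them, and [Z] bounds the logarithm of one
   plus the conditional chi-square distance of a row from pure noise. *)
Let ell b : N.-tuple T -> R := LR (fun t => if K t && (tau t == Some b) then h else 0).
Let V b y := 1 - th b + th b * ell b y.
Let Y e := LR (shift K e).
Let F y := \sum_e bernw th e * Y e y.
Let hat b y := th b * ell b y / V b y.
Let kap b := expR (A * (block_count (predU T1 T2) b)%:R) - 1.
Let Z y := \sum_b kap b * hat b y ^+ 2.

Let ell_gt0 b y : 0 < ell b y. Proof. exact: lr_gt0. Qed.
Let Y_gt0 e y : 0 < Y e y. Proof. exact: lr_gt0. Qed.

Let V_gt0 b y : 0 < V b y.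
Proof.
have [t0 t1] := andP (th01 b); have l0 := ell_gt0 b y.
rewrite /V; have [->|tn1] := eqVneq (th b) 1; first by rewrite subrr add0r mul1r.
have t1' : th b < 1 by rewrite lt_neqAle tn1.
have tl : 0 <= th b * ell b y by rewrite mulr_ge0// ltW.
by lra.
Qed.

Let V_neq0 b y : V b y != 0. Proof. by rewrite gt_eqF. Qed.

Let YE e y : Y e y = \prod_b (if e b then ell b y else 1).
Proof.
rewrite /Y /ell lrE.
transitivity (\prod_t \prod_b (if [&& K t, tau t == Some b & e b]
    then gauss_lr s (mu t) h (tnth y t) else 1)).
  apply: eq_bigr => t _; rewrite /shift /switched.
  case: (tau t) => [b|]; last first.
    by rewrite andbF gauss_lr0 big1// => b _; rewrite andbF.
  rewrite (bigD1 b)//= eqxx big1 ?mulr1; last first.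
    move=> b' b'b; rewrite (_ : (Some b == Some b') = false) ?andbF//.
    by apply/negbTE; apply: contra b'b => /eqP[->].
  by rewrite /=; case: ifP => //; rewrite gauss_lr0.
rewrite exchange_big; apply: eq_bigr => b _ /=.
case: ifP => eb; rewrite ?lrE; last by apply: big1 => t _; rewrite !andbF.
apply: eq_bigr => t _; rewrite andbT; case: ifP => //.
by rewrite gauss_lr0.
Qed.

Let FE y : F y = \prod_b V b y.
Proof. by rewrite -sum_bernw_prod; apply: eq_bigr => e _; rewrite YE. Qed.

Let F_gt0 y : 0 < F y.
Proof. by rewrite FE; apply: prodr_gt0 => b _. Qed.

Let kap_ge0 b : 0 <= kap b.
Proof. by rewrite subr_ge0 -[leLHS]expR0 ler_expR mulr_ge0// divr_ge0// sqr_ge0. Qed.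

Let Z_ge0 y : 0 <= Z y.
Proof. by apply: sumr_ge0 => b _; rewrite mulr_ge0// sqr_ge0. Qed.

Let mF : measurable_fun setT F.
Proof. by apply: measurable_sum => e; apply: measurable_funM => //; exact: measurable_lr. Qed.

Let mV b : measurable_fun setT (V b).
Proof.
by apply: measurable_funD => //; apply: measurable_funM => //; exact: measurable_lr.
Qed.

Let mhat b : measurable_fun setT (hat b).
Proof.
apply: measurable_funM; last by apply: measurable_funV_gt0 => //; exact: V_gt0.
by apply: measurable_funM => //; exact: measurable_lr.
Qed.

Let mZ : measurable_fun setT Z.
Proof.
apply: measurable_sum => b; apply: measurable_funM => //.
by apply: measurable_funX; exact: mhat.
Qed.

Let P0_lr a : (\int[P0]_y (LR a y)%:E = 1)%E.
Proof. exact: integral_lr. Qed.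

Let P0_F : (\int[P0]_y (F y)%:E = 1)%E.
Proof.
rewrite ge0_integral_EFin_sum; last 3 first.
- by move=> e; exact: measurable_lr.
- by move=> e; exact: bernw_ge0.
- by move=> e y; exact: ltW.
under eq_bigr => e _ do rewrite (P0_lr (shift K e)) mule1.
by rewrite sumEFin sum_bernw.
Qed.

Definition block_bound b : R :=
  if th b == 1 then 1 else 2 * th b ^+ 2 * expR (A * (block_count K b)%:R).

(* Unless [th b = 1], [V b >= 2^-1] trades one factor of the posterior for the
   likelihood of the mixture in which the switch [b] is forced on. *)
Let P0_F_hat b : (\int[P0]_y (F y * hat b y ^+ 2)%:E <= (block_bound b)%:E)%E.
Proof.
have mFh : measurable_fun setT (fun y => F y * hat b y ^+ 2).
  by apply: measurable_funM => //; apply: measurable_funX; exact: mhat.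
have Fh0 y : 0 <= F y * hat b y ^+ 2 by rewrite mulr_ge0// ?sqr_ge0// ltW.
rewrite /block_bound; case: ifPn => [/eqP t1|tn1].
  rewrite -P0_F; apply: ge0_le_integral_EFin => // y.
  rewrite /hat /V t1 subrr add0r mul1r divff ?gt_eqF//.
  by rewrite expr1n mulr1.
have th2 : th b <= 2^-1 by case: (thP b) => // t1; rewrite t1 eqxx in tn1.
have [t0 _] := andP (th01 b).
pose th' c := if c == b then 1 else th c.
have th'01 c : 0 <= th' c <= 1 by rewrite /th'; case: ifP => // _; rewrite ler01 lexx.
pose aE e t := shift K e t * (if K t && (tau t == Some b) then h else 0) / s ^+ 2.
apply: (@le_trans _ _ (\int[P0]_y (\sum_e (2 * th b ^+ 2 * bernw th' e) *
    (Y e y * ell b y))%:E)%E).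
  apply: ge0_le_integral_EFin => //.
    apply: measurable_sum => e; do 2 apply: measurable_funM => //.
      exact: measurable_lr.
    exact: measurable_lr.
  move=> y; rewrite FE (bigD1 b)//=.
  have -> : \sum_e (2 * th b ^+ 2 * bernw th' e) * (Y e y * ell b y) =
      2 * th b ^+ 2 * ell b y * \sum_e bernw th' e * Y e y.
    by rewrite mulr_sumr; apply: eq_bigr => e _; ring.
  have -> : \sum_e bernw th' e * Y e y = ell b y * \prod_(c | c != b) V c y.
    transitivity (\sum_e bernw th' e * \prod_c (if e c then ell c y else 1)).
      by apply: eq_bigr => e _; rewrite YE.
    rewrite sum_bernw_prod (bigD1 b)//= /th' eqxx subrr add0r mul1r; congr *%R.
    by apply: eq_bigr => c /negbTE ->.
  set W := \prod_(c | _) _; have W0 : 0 <= W by apply: prodr_ge0 => c _; exact: ltW.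
  have -> : V b y * W * hat b y ^+ 2 = (th b * ell b y) ^+ 2 / V b y * W.
    by rewrite /hat; have := V_neq0 b y; move: (V b y) => v v0; field.
  have -> : 2 * th b ^+ 2 * ell b y * (ell b y * W) = 2 * (th b * ell b y) ^+ 2 * W.
    by ring.
  apply: ler_wpM2r => //; rewrite ler_pdivrMr//.
  have : 2^-1 <= V b y by rewrite /V; have := mulr_ge0 t0 (ltW (ell_gt0 b y)); lra.
  by have := sqr_ge0 (th b * ell b y); nra.
rewrite ge0_integral_EFin_sum; last 3 first.
- by move=> e; apply: measurable_funM; exact: measurable_lr.
- by move=> e; rewrite !mulr_ge0// ?sqr_ge0// bernw_ge0.
- by move=> e y; rewrite mulr_ge0// ltW.
apply: (@le_trans _ _ (\sum_e (2 * th b ^+ 2 * bernw th' e)%:E *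
   (expR (A * (block_count K b)%:R))%:E)%E); last first.
  under eq_bigr do rewrite -EFinM.
  by rewrite sumEFin lee_fin -mulr_suml -mulr_sumr sum_bernw mulr1.
apply: lee_sum => e _; apply: lee_wpmul2l.
  by rewrite lee_fin !mulr_ge0// ?sqr_ge0// bernw_ge0.
pose e1 : {ffun I -> bool} := [ffun c => c == b].
have ellE : ell b = LR (shift K e1).
  apply: eq_lr => t; rewrite /shift /switched; case: (tau t) => [c|]; last by rewrite andbF.
  by rewrite ffunE.
rewrite ellE /Y; under eq_integral do rewrite lr_mul//.
rewrite ge0_integral_EFinZ//; last 2 first.
- exact: measurable_lr.
- by move=> y; exact/ltW/lr_gt0.
rewrite P0_lr mule1 lee_fin expR_switched (bigD1 b)//= ffunE eqxx andbT.
rewrite big1 ?mulr1; last by move=> c cb; rewrite ffunE (negbTE cb) andbF.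
by case: ifP => // _; rewrite -[leLHS]expR0 ler_expR mulr_ge0// divr_ge0// sqr_ge0.
Qed.

Lemma lr_local (D : pred 'I_N) (a : 'I_N -> R) (y y' : N.-tuple T) :
  (forall t, ~~ D t -> a t = 0) -> (forall t, D t -> tnth y t = tnth y' t) ->
  LR a y = LR a y'.
Proof.
move=> a0 yy'; rewrite !lrE; apply: eq_bigr => t _.
by have [Dt|Dt] := boolP (D t); [rewrite yy'|rewrite a0// !gauss_lr0].
Qed.

Lemma integral_lr_local (D : pred 'I_N) (a : 'I_N -> R) (H : N.-tuple T -> R) :
  measurable_fun setT H -> (forall y, 0 <= H y) ->
  (forall t, ~~ D t -> a t = 0) ->
  (forall y y', (forall t, ~~ D t -> tnth y t = tnth y' t) -> H y = H y') ->
  (\int[P0]_y (H y * LR a y)%:E = \int[P0]_y (H y)%:E)%E.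
Proof.
move=> mH H0 a0 Hloc.
have mHE : measurable_fun setT (fun y => (H y)%:E) by exact/measurable_EFinP.
under eq_integral do rewrite EFinM.
apply: etrans; first apply: esym; first apply: integral_product_shift => //.
apply: (@product_law_indep _ _ _ _ D); [exact: mHE| | |].
- by move=> y; rewrite lee_fin.
- by move=> t /a0 ->; rewrite addr0.
- by move=> y y' /Hloc ->.
Qed.

Let hat_local b y y' : (forall t, K t -> tnth y t = tnth y' t) -> hat b y = hat b y'.
Proof.
move=> yy'; rewrite /hat /V.
suff -> : ell b y = ell b y' by [].
by apply: (@lr_local K) => // t /negbTE ->.
Qed.

Let Y_local e y y' : (forall t, K t -> tnth y t = tnth y' t) -> Y e y = Y e y'.
Proof.
by move=> yy'; apply: (@lr_local K) => // t; rewrite /shift => /negbTE ->.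
Qed.

Let F_local y y' : (forall t, K t -> tnth y t = tnth y' t) -> F y = F y'.
Proof. by move=> yy'; apply: eq_bigr => e _; rewrite (Y_local e yy'). Qed.

(* The second moment of a row has size [expR (Z y)], hence the truncation to the
   event where [Z] is small. *)
Let G y : R := if Z y <= 2^-1 then 1 else 0.

Let G_local y y' : (forall t, K t -> tnth y t = tnth y' t) -> G y = G y'.
Proof.
move=> yy'; rewrite /G; suff -> : Z y = Z y' by [].
by apply: eq_bigr => b _; rewrite (hat_local b yy').
Qed.

Let G_ge0 y : 0 <= G y. Proof. by rewrite /G; case: ifP. Qed.

Let mG : measurable_fun setT G.
Proof. by apply: measurable_fun_ifT => //; exact: measurable_fun_ler. Qed.

Let mY e : measurable_fun setT (Y e). Proof. exact: measurable_lr. Qed.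

Let P0_FZ : (\int[P0]_y (F y * Z y)%:E <= (\sum_b kap b * block_bound b)%:E)%E.
Proof.
have FZE y : F y * Z y = \sum_b kap b * (F y * hat b y ^+ 2).
  by rewrite /Z mulr_sumr; apply: eq_bigr => b _; rewrite mulrCA.
under eq_integral do rewrite FZE.
rewrite ge0_integral_EFin_sum//; last 2 first.
- by move=> b; apply: measurable_funM => //; apply: measurable_funX; exact: mhat.
- by move=> b y; rewrite mulr_ge0// ?sqr_ge0// ltW.
rewrite -sumEFin; apply: lee_sum => b _; rewrite EFinM.
by apply: lee_wpmul2l => //; rewrite lee_fin.
Qed.

Section OneRow.
Variable D : pred 'I_N.
Hypothesis DK : forall t, D t -> ~~ K t.
Let X e := LR (shift D e).
Let FD y := \sum_e bernw th e * (Y e y * X e y).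

Let X_gt0 e y : 0 < X e y. Proof. exact: lr_gt0. Qed.
Let mX e : measurable_fun setT (X e). Proof. exact: measurable_lr. Qed.

Let agree (y y' : N.-tuple T) : (forall t, ~~ D t -> tnth y t = tnth y' t) ->
  forall t, K t -> tnth y t = tnth y' t.
Proof. by move=> yy' t Kt; apply: yy'; apply/negP => /DK; rewrite Kt. Qed.

Let shift_off e t : ~~ D t -> shift D e t = 0.
Proof. by rewrite /shift => /negbTE ->. Qed.

Let mFD : measurable_fun setT FD.
Proof. by apply: measurable_sum => e; do 2 apply: measurable_funM => //. Qed.

Let FD_ge0 y : 0 <= FD y.
Proof.
by apply: sumr_ge0 => e _; rewrite mulr_ge0 ?bernw_ge0//; apply/ltW/mulr_gt0.
Qed.

Let P0_GFD : (\int[P0]_y (G y * FD y)%:E = \int[P0]_y (G y * F y)%:E)%E.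
Proof.
transitivity (\int[P0]_y (\sum_e bernw th e * (G y * Y e y * X e y))%:E)%E.
  apply: eq_integral => y _; congr (_%:E); rewrite mulr_sumr.
  by apply: eq_bigr => e _; rewrite mulrCA !mulrA.
transitivity (\int[P0]_y (\sum_e bernw th e * (G y * Y e y))%:E)%E; last first.
  apply: eq_integral => y _; congr (_%:E); rewrite mulr_sumr.
  by apply: eq_bigr => e _; rewrite mulrCA.
have GY0 e y : 0 <= G y * Y e y by rewrite mulr_ge0// ltW.
have mGY e : measurable_fun setT (fun y => G y * Y e y) by exact: measurable_funM.
rewrite ge0_integral_EFin_sum; last 3 first.
- by move=> e; exact: measurable_funM.
- by move=> e; exact: bernw_ge0.
- by move=> e y; apply: mulr_ge0 => //; exact: ltW.
rewrite (ge0_integral_EFin_sum _ _ mGY _ GY0); last by move=> e; exact: bernw_ge0.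
apply: eq_bigr => e _; congr *%E; apply: (@integral_lr_local D); [exact: mGY|exact: GY0| |].
- by move=> t; exact: shift_off.
- by move=> y y' /agree yy'; rewrite (G_local yy') (Y_local e yy').
Qed.

Let P0_GFD2 :
  (\int[P0]_y (G y * (FD y ^+ 2 / F y))%:E <=
   \int[P0]_y (G y * F y)%:E + 2%:E * \int[P0]_y (F y * Z y)%:E)%E.
Proof.
have mV1 : measurable_fun setT (fun y => (F y)^-1) by exact: measurable_funV_gt0.
pose c (p : {ffun I -> bool} * {ffun I -> bool}) := bernw th p.1 * bernw th p.2 *
  expR (\sum_t shift D p.1 t * shift D p.2 t / s ^+ 2).
pose H (p : {ffun I -> bool} * {ffun I -> bool}) y := G y * (Y p.1 y * Y p.2 y / F y).
have c0 p : 0 <= c p by rewrite !mulr_ge0 ?bernw_ge0 ?expR_ge0.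
have H0 p y : 0 <= H p y.
  by apply: mulr_ge0 => //; apply/ltW/divr_gt0 => //; exact: mulr_gt0.
have mH p : measurable_fun setT (H p) by do 3 apply: measurable_funM => //.
apply: (@le_trans _ _ (\int[P0]_y (\sum_p c p * H p y)%:E)%E).
  rewrite le_eqVlt; apply/orP; left; apply/eqP.
  transitivity (\int[P0]_y (\sum_p c p * (H p y *
      LR (fun t => shift D p.1 t + shift D p.2 t) y))%:E)%E.
    apply: eq_integral => y _; congr (_%:E).
    rewrite expr2 /FD mulr_suml mulr_suml mulr_sumr.
    rewrite -(pair_big xpredT xpredT (fun e e' => c (e, e') * (H (e, e') y *
      LR (fun t => shift D e t + shift D e' t) y)))/=.
    apply: eq_bigr => e _; rewrite mulr_sumr mulr_suml mulr_sumr.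
    apply: eq_bigr => e' _; rewrite /c /H /=.
    have := lr_mul mu (shift D e) (shift D e') y s0.
    rewrite -/(X e y) -/(X e' y) => XX.
    transitivity (bernw th e * bernw th e' * (G y * (Y e y * Y e' y / F y)) * (X e y * X e' y)).
      by ring.
    by rewrite XX; ring.
  rewrite !ge0_integral_EFin_sum//; last 2 first.
  - by move=> p; apply: measurable_funM => //; exact: measurable_lr.
  - by move=> p y; apply: mulr_ge0 => //; exact/ltW/lr_gt0.
  apply: eq_bigr => p _; congr *%E; apply: (@integral_lr_local D) => //.
  - by move=> t Dt; rewrite !shift_off// addr0.
  - move=> y y' /agree yy'.
    by rewrite /H (G_local yy') !(Y_local _ yy') (F_local yy').
rewrite -ge0_integral_EFinZ; last 3 first.
- exact: measurable_funM.
- by [].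
- by move=> y; apply: mulr_ge0 => //; exact: ltW.
rewrite -ge0_integral_EFinD; last 4 first.
- exact: measurable_funM.
- by apply: measurable_funM => //; exact: measurable_funM.
- by move=> y; apply: mulr_ge0 => //; exact: ltW.
- by move=> y; rewrite !mulr_ge0//; exact: ltW.
apply: ge0_le_integral_EFin.
- by apply: measurable_sum => p; apply: measurable_funM.
- by apply: measurable_funD; do ?apply: measurable_funM => //.
- by move=> y; apply: sumr_ge0 => p _; exact: mulr_ge0.
move=> y.
pose k b := expR (A * (block_count D b)%:R).
have k1 b : 1 <= k b by rewrite /k -[leLHS]expR0 ler_expR mulr_ge0// divr_ge0// sqr_ge0.
have kk b : k b - 1 <= kap b.
  rewrite /k /kap lerD2r ler_expR; apply: ler_wpM2l.
    by rewrite divr_ge0// sqr_ge0.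
  rewrite ler_nat; apply: subset_leq_card; apply/fintype.subsetP => t.
  by rewrite !inE => /andP[/DK]; rewrite negbK => /orP[]->->; rewrite ?orbT.
have -> : \sum_p c p * H p y = G y / F y *
    \prod_b (V b y ^+ 2 + (k b - 1) * (th b * ell b y) ^+ 2).
  rewrite -sum_bernw_prod2 mulr_sumr.
  rewrite -(pair_big xpredT xpredT (fun e e' => c (e, e') * H (e, e') y))/=.
  apply: eq_bigr => e _; rewrite mulr_sumr; apply: eq_bigr => e' _.
  by rewrite /c /H /= expR_switched !YE; ring.
have -> : \prod_b (V b y ^+ 2 + (k b - 1) * (th b * ell b y) ^+ 2) =
    F y ^+ 2 * \prod_b (1 + (k b - 1) * hat b y ^+ 2).
  rewrite FE -prodrXl -big_split; apply: eq_bigr => b _ /=.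
  by rewrite /hat; have := V_neq0 b y; move: (V b y) => v v0; field.
have Fn0 : F y != 0 by rewrite gt_eqF.
have -> : G y / F y * (F y ^+ 2 * \prod_b (1 + (k b - 1) * hat b y ^+ 2)) =
  G y * F y * \prod_b (1 + (k b - 1) * hat b y ^+ 2).
  by move: (F y) Fn0 => v v0; field.
have le1 : \prod_b (1 + (k b - 1) * hat b y ^+ 2) <= expR (Z y).
  apply: (@le_trans _ _ (expR (\sum_b (k b - 1) * hat b y ^+ 2))).
    by apply: prod_1D_le_expR => b; rewrite mulr_ge0 ?sqr_ge0// subr_ge0.
  rewrite ler_expR; apply: ler_sum => b _; apply: ler_wpM2r => //; exact: sqr_ge0.
rewrite /G; case: ifP => Zy; last first.
  by rewrite !mul0r add0r mulr_ge0// mulr_ge0// ltW.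
rewrite !mul1r; apply: (@le_trans _ _ (F y * (1 + 2 * Z y))); last lra.
rewrite ler_pM2l//; apply: le_trans le1 _.
exact: expR_le1D2.
Qed.

Lemma one_row_chi2 :
  (\int[P0]_y (G y * ((FD y - F y) ^+ 2 / F y))%:E <=
   2%:E * \int[P0]_y (F y * Z y)%:E)%E.
Proof.
have mV1 : measurable_fun setT (fun y => (F y)^-1) by exact: measurable_funV_gt0.
have mGF : measurable_fun setT (fun y => G y * F y) by exact: measurable_funM.
have GF0 y : 0 <= G y * F y by apply: mulr_ge0 => //; exact: ltW.
set b := (\int[P0]_y (G y * F y)%:E)%E.
have b_fin : b \is a fin_num.
  apply/fin_real/andP; split.
    by apply: lt_le_trans (ltNy0) _; apply: integral_ge0 => y _; rewrite lee_fin.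
  apply: le_lt_trans (ltry 1); rewrite -P0_F; apply: ge0_le_integral_EFin => // y.
  by rewrite /G; case: ifP => _; rewrite ?mul1r ?mul0r// ltW.
rewrite -(leeD2rE _ _ (_ : (b + b)%E \is a fin_num)); last by rewrite fin_numD b_fin.
pose f1 y := G y * ((FD y - F y) ^+ 2 / F y); pose f2 y := G y * FD y.
pose f3 y := G y * (FD y ^+ 2 / F y); pose f4 y := G y * F y.
have m1 : measurable_fun setT f1.
  apply: measurable_funM => //; apply: measurable_funM => //.
  by apply: measurable_funX; exact: measurable_funB.
have m2 : measurable_fun setT f2 by exact: measurable_funM.
have m3 : measurable_fun setT f3.
  by apply: measurable_funM => //; apply: measurable_funM => //; exact: measurable_funX.
have f10 y : 0 <= f1 y by apply: mulr_ge0 => //; rewrite divr_ge0 ?sqr_ge0// ltW.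
have f20 y : 0 <= f2 y by exact: mulr_ge0.
have f30 y : 0 <= f3 y by apply: mulr_ge0 => //; rewrite divr_ge0 ?sqr_ge0// ltW.
have -> : (\int[P0]_y (f1 y)%:E + (b + b) = \int[P0]_y (f3 y)%:E + b)%E.
  apply: (@etrans _ _ (\int[P0]_y (f1 y + (f2 y + f2 y))%:E)%E).
    rewrite (ge0_integral_EFinD _ m1 (measurable_funD m2 m2) f10)//; last first.
      by move=> y; exact: addr_ge0.
    by rewrite (ge0_integral_EFinD _ m2 m2 f20 f20) P0_GFD.
  rewrite -(ge0_integral_EFinD _ m3 mGF f30 GF0); apply: eq_integral => y _; congr (_%:E).
  have Fn0 : F y != 0 by rewrite gt_eqF.
  by rewrite /f1 /f2 /f3; move: (F y) Fn0 => v v0; field.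
apply: le_trans (leeD P0_GFD2 (lexx b)) _.
by rewrite [X in (X + _ <= _)%E]addeC -addeA.
Qed.

End OneRow.

Let row (D : pred 'I_N) y := \sum_e bernw th e * (Y e y * LR (shift D e) y).

Let row_ge0 D y : 0 <= row D y.
Proof.
by apply: sumr_ge0 => e _; rewrite mulr_ge0 ?bernw_ge0//; apply/ltW/mulr_gt0 => //; exact: lr_gt0.
Qed.

Let m_row D : measurable_fun setT (row D).
Proof.
by apply: measurable_sum => e; do 2 apply: measurable_funM => //; exact: measurable_lr.
Qed.

Let mV1 : measurable_fun setT (fun y => (F y)^-1).
Proof. exact: measurable_funV_gt0. Qed.

Let P0_row (D C : pred 'I_N) (f : N.-tuple T -> R) :
  measurable_fun setT f -> (forall y, 0 <= f y) ->
  (forall t, C t = K t || D t) -> (forall t, D t -> ~~ K t) ->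
  (\int[P0]_y (f y * row D y)%:E = \sum_e (bernw th e)%:E *
     \int[product_law (fun t => gauss_law (mu t + shift C e t) s)]_y (f y)%:E)%E.
Proof.
move=> mf f0 CE DK.
transitivity (\int[P0]_y (\sum_e bernw th e * (f y * LR (shift C e) y))%:E)%E.
  apply: eq_integral => y _; congr (_%:E); rewrite mulr_sumr.
  apply: eq_bigr => e _; rewrite mulrCA; congr (_ * (_ * _)).
  rewrite /Y lr_mul_disj => [|t]; last first.
    rewrite /shift; have := DK t; case: (D t); case: (K t) => //= k; rewrite ?mul0r ?mulr0//.
    by have := k isT.
  congr (LR _ y); apply/funext => t; rewrite /shift CE.
  have := DK t; case: (D t); case: (K t) => //= k; rewrite ?addr0 ?add0r//.
  by have := k isT.
have mfl e : measurable_fun setT (fun y => f y * LR (shift C e) y).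
  by apply: measurable_funM => //; exact: measurable_lr.
have fl0 e y : 0 <= f y * LR (shift C e) y.
  by apply: mulr_ge0 => //; exact/ltW/lr_gt0.
have w0 e : 0 <= bernw th e by exact: bernw_ge0.
apply: etrans; first exact: (ge0_integral_EFin_sum P0 _ mfl w0 fl0).
have mfE : measurable_fun setT (fun y => (f y)%:E) by exact/measurable_EFinP.
have f0E y : (0 <= (f y)%:E)%E by rewrite lee_fin.
have change e : (\int[P0]_y (f y * LR (shift C e) y)%:E =
    \int[product_law (fun t => gauss_law (mu t + shift C e t) s)]_y (f y)%:E)%E.
  apply: esym; apply: etrans; first exact: (integral_product_shift mu (shift C e) s0 mfE f0E).
  by apply: eq_integral => y _; rewrite EFinM.
by apply: eq_bigr => e _; exact: (congr1 (mule (bernw th e)%:E) (change e)).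
Qed.

Hypothesis T12 : forall t, ~~ (T1 t && T2 t).

(* Le Cam's method, both hypotheses being compared with the mixture in which
   neither row is shifted. *)
Lemma mixture_test (S : set (N.-tuple T)) : measurable S ->
  ((3 / 4)%:E <= \sum_e (bernw th e)%:E *
     (product_law (fun t => gauss_law (mu t + shift (predC T2) e t) s) S +
      product_law (fun t => gauss_law (mu t + shift (predC T1) e t) s) (~` S))
   + (6 * \sum_b (expR (A * (block_count (predU T1 T2) b)%:R) - 1) * block_bound b)%:E)%E.
Proof.
move=> mS; pose f1 y : R := \1_S y; pose f2 y : R := \1_(~` S) y.
have mf1 : measurable_fun setT f1 by exact: measurable_indic.
have mf2 : measurable_fun setT f2 by apply: measurable_indic; exact: measurableC.
have f10 y : 0 <= f1 y by rewrite /f1 indicE.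
have f20 y : 0 <= f2 y by rewrite /f2 indicE.
have D1 t : T1 t -> ~~ K t by rewrite negbK => ->.
have D2 t : T2 t -> ~~ K t by rewrite negbK => ->; rewrite orbT.
have C1 t : predC T2 t = K t || T1 t.
  by rewrite /K /=; have := T12 t; case: (T1 t); case: (T2 t).
have C2 t : predC T1 t = K t || T2 t.
  by rewrite /K /=; have := T12 t; case: (T1 t); case: (T2 t).
pose u1 y := f1 y * row T1 y; pose u2 y := f2 y * row T2 y.
pose q D y := G y * ((row D y - F y) ^+ 2 / F y).
pose r y := 2 * (F y * Z y).
have mu1 : measurable_fun setT u1 by exact: measurable_funM.
have mu2 : measurable_fun setT u2 by exact: measurable_funM.
have mq D : measurable_fun setT (q D).
  apply: measurable_funM => //; apply: measurable_funM => //.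
  by apply: measurable_funX; exact: measurable_funB.
have mr : measurable_fun setT r by apply: measurable_funM => //; exact: measurable_funM.
have u10 y : 0 <= u1 y by exact: mulr_ge0.
have u20 y : 0 <= u2 y by exact: mulr_ge0.
have q0 D y : 0 <= q D y by apply: mulr_ge0 => //; rewrite divr_ge0 ?sqr_ge0// ltW.
have r0 y : 0 <= r y by rewrite mulr_ge0// mulr_ge0// ltW.
have pointwise y : 3 / 4 * F y <= (u1 y + u2 y) + (r y + (q T1 y + q T2 y)).
  have F0 := F_gt0 y; have Z0 := Z_ge0 y.
  have := u10 y; have := u20 y; have := q0 T1 y; have := q0 T2 y.
  rewrite /r; case: (leP (Z y) 2^-1) => Zy; last by nra.
  rewrite /q /G Zy !mul1r => q20 q10 u20' u10'.
  have sq D : 3 / 4 * F y <= row D y + (row D y - F y) ^+ 2 / F y.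
    rewrite -subr_ge0.
    have -> : row D y + (row D y - F y) ^+ 2 / F y - 3 / 4 * F y =
       (row D y - F y / 2) ^+ 2 / F y.
      by move: (F y) (lt0r_neq0 F0) => v v0; field.
    by rewrite divr_ge0 ?sqr_ge0// ltW.
  have FZ0 : 0 <= F y * Z y by rewrite mulr_ge0// ltW.
  have [Sy|Sy] := boolP (y \in S).
    have -> : u1 y = row T1 y by rewrite /u1 /f1 indicE Sy mul1r.
    by have := sq T1; lra.
  have -> : u2 y = row T2 y by rewrite /u2 /f2 indicE in_setC Sy mul1r.
  by have := sq T2; lra.
have step : ((3 / 4)%:E <= (\int[P0]_y (u1 y)%:E + \int[P0]_y (u2 y)%:E) +
   (2%:E * \int[P0]_y (F y * Z y)%:E + (\int[P0]_y (q T1 y)%:E + \int[P0]_y (q T2 y)%:E)))%E.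
  have -> : (3 / 4)%:E = (\int[P0]_y (3 / 4 * F y)%:E)%E.
    have c0 : 0 <= 3 / 4 :> R by lra.
    apply: esym; apply: etrans.
      exact: (ge0_integral_EFinZ P0 mF c0 (fun y => ltW (F_gt0 y))).
    by rewrite P0_F mule1.
  have <- : (\int[P0]_y (r y)%:E = 2%:E * \int[P0]_y (F y * Z y)%:E)%E.
    apply: ge0_integral_EFinZ => //; first exact: measurable_funM.
    by move=> y; rewrite mulr_ge0// ltW.
  rewrite -(ge0_integral_EFinD _ mu1 mu2 u10 u20).
  rewrite -(ge0_integral_EFinD _ (mq T1) (mq T2) (q0 T1) (q0 T2)).
  have mqq := measurable_funD (mq T1) (mq T2).
  have qq0 y : 0 <= q T1 y + q T2 y by exact: addr_ge0.
  rewrite -(ge0_integral_EFinD _ mr mqq r0 qq0).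
  have uu0 y : 0 <= u1 y + u2 y by exact: addr_ge0.
  have rqq0 y : 0 <= r y + (q T1 y + q T2 y) by exact: addr_ge0.
  rewrite -(ge0_integral_EFinD _ (measurable_funD mu1 mu2) (measurable_funD mr mqq) uu0 rqq0).
  apply: ge0_le_integral_EFin.
  - exact: measurable_funM.
  - by apply: measurable_funD; [exact: measurable_funD|exact: measurable_funD].
  - by move=> y; apply: mulr_ge0; [lra|exact: ltW].
  - exact: pointwise.
apply: (le_trans step); apply: leeD.
  apply: le_trans (leeD (eq_lee (P0_row mf1 f10 C1 D1)) (eq_lee (P0_row mf2 f20 C2 D2))) _.
  have distr (w a b a' b' : \bar R) : (0 <= w)%E -> (0 <= a)%E -> (0 <= b)%E ->
      a' = a -> b' = b -> (w * a' + w * b' <= w * (a + b))%E.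
    by move=> w0 a0 b0 -> ->; rewrite ge0_muleDr.
  rewrite -big_split; apply: lee_sum => e _; apply: distr.
  - by rewrite lee_fin bernw_ge0.
  - exact: measure_ge0.
  - exact: measure_ge0.
  - exact: integral_EFin_indic.
  - by apply: integral_EFin_indic; exact: measurableC.
have : ((6 * \sum_b (expR (A * (block_count (predU T1 T2) b)%:R) - 1) * block_bound b)%:E =
  2%:E * (\sum_b kap b * block_bound b)%:E + (2%:E * (\sum_b kap b * block_bound b)%:E +
  2%:E * (\sum_b kap b * block_bound b)%:E))%E.
  by rewrite -!EFinM -!EFinD; congr (_%:E); rewrite /kap; ring.
move=> ->; have c2 : (0 <= 2%:E :> \bar R)%E by rewrite lee_fin.
have FZ := lee_wpmul2l c2 P0_FZ.
apply: leeD => //; apply: leeD.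
- exact: le_trans (one_row_chi2 D1) FZ.
- exact: le_trans (one_row_chi2 D2) FZ.
Qed.

End MixtureTest.

(** * Averages over the observed positions *)

Section SampleMean.
Context (R : realType) (n d : nat) (lam : R).
Hypotheses (lam0 : 0 < lam) (n0 : (0 < n)%N) (d0 : (0 < d)%N).
Local Notation pos := ('I_n * 'I_d)%type.
Implicit Types f g : forall N, N.-tuple pos -> \bar R.

Definition sample_mean f : \bar R :=
  (\int[poisson_prob (lam * n%:R * d%:R) 0]_N
     \sum_(x : N.-tuple pos) (\prod_(t < N) ((n * d)%:R)^-1)%R%:E * f N x)%E.

Lemma eq_sample_mean f g : (forall N x, f N x = g N x) -> sample_mean f = sample_mean g.
Proof.
by move=> fg; apply: eq_integral => N _; apply: eq_bigr => x _; rewrite fg.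
Qed.

Lemma prodV_ge0 N : (0 <= (\prod_(t < N) ((n * d)%:R)^-1)%:E :> \bar R)%E.
Proof. by rewrite lee_fin; apply: prodr_ge0 => t _; rewrite invr_ge0. Qed.

Lemma sample_sum_ge0 f N : (forall N x, 0 <= f N x)%E ->
  (0 <= \sum_(x : N.-tuple pos) (\prod_(t < N) ((n * d)%:R)^-1)%R%:E * f N x)%E.
Proof. by move=> f0; apply: sume_ge0 => x _; rewrite mule_ge0// prodV_ge0. Qed.

Lemma sample_mean_ge0 f : (forall N x, 0 <= f N x)%E -> (0 <= sample_mean f)%E.
Proof. by move=> f0; apply: integral_ge0 => N _; exact: sample_sum_ge0. Qed.

Lemma le_sample_mean f g : (forall N x, 0 <= f N x)%E ->
  (forall N x, f N x <= g N x)%E -> (sample_mean f <= sample_mean g)%E.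
Proof.
move=> f0 fg; apply: ge0_le_integral => //.
- by move=> N _; exact: sample_sum_ge0.
- by move=> N _; apply: lee_sum => x _; apply: lee_wpmul2l; [exact: prodV_ge0|].
Qed.

Lemma sample_mean_sum (K : finType) (c : K -> R) (f : K -> forall N, N.-tuple pos -> \bar R) :
  (forall k, 0 <= c k) -> (forall k N x, 0 <= f k N x)%E ->
  (sample_mean (fun N x => \sum_k (c k)%:E * f k N x) =
   \sum_k (c k)%:E * sample_mean (f k))%E.
Proof.
move=> c0 f0; have cf0 k N x : (0 <= (c k)%:E * f k N x)%E by rewrite mule_ge0// lee_fin.
rewrite /sample_mean.
transitivity (\int[poisson_prob (lam * n%:R * d%:R) 0]_N (\sum_k (c k)%:E *
  \sum_(x : N.-tuple pos) (\prod_(t < N) ((n * d)%:R)^-1)%R%:E * f k N x))%E.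
  apply: eq_integral => N _.
  under eq_bigr => x _ do rewrite ge0_sume_distrr//.
  rewrite exchange_big; apply: eq_bigr => k _ /=.
  rewrite ge0_sume_distrr => [|x _]; last by rewrite mule_ge0// prodV_ge0.
  by apply: eq_bigr => x _; rewrite muleCA.
rewrite ge0_integral_sum//; last first.
  by move=> k N _; rewrite mule_ge0 ?lee_fin// sample_sum_ge0.
apply: eq_bigr => k _; rewrite ge0_integralZl_EFin//.
by move=> N _; exact: sample_sum_ge0.
Qed.

Lemma sample_meanD f g : (forall N x, 0 <= f N x)%E -> (forall N x, 0 <= g N x)%E ->
  (sample_mean (fun N x => f N x + g N x) = sample_mean f + sample_mean g)%E.
Proof.
move=> f0 g0; have := @sample_mean_sum bool (fun=> 1) (fun b => if b then f else g).
rewrite big_bool /= !mul1e => <- //; last by case.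
by apply: eq_sample_mean => N x; rewrite big_bool !mul1e.
Qed.

Lemma sample_meanZ (c : R) f : 0 <= c -> (forall N x, 0 <= f N x)%E ->
  (sample_mean (fun N x => c%:E * f N x) = c%:E * sample_mean f)%E.
Proof.
move=> c0 f0; have := @sample_mean_sum unit (fun=> c) (fun=> f).
rewrite (big_pred1 tt) /=; last by case.
move=> <- //.
apply: eq_sample_mean => N x.
by rewrite (big_pred1 tt)//; case.
Qed.

Lemma sum_tuple_prod N (rho : pos -> R) :
  \sum_(x : N.-tuple pos) \prod_(t < N) rho (tnth x t) = (\sum_p rho p) ^+ N.
Proof.
have -> : (\sum_p rho p) ^+ N = \prod_(t < N) \sum_p rho p by rewrite prodr_const card_ord.
rewrite bigA_distr_bigA /=.
rewrite (reindex (fun f : {ffun 'I_N -> pos} => [tuple f i | i < N])) /=; last first.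
  exists (fun x : N.-tuple pos => [ffun i => tnth x i]) => x _.
    by apply/ffunP => i; rewrite ffunE tnth_mktuple.
  by apply: eq_from_tnth => i; rewrite tnth_mktuple ffunE.
by apply: eq_bigr => f _; apply: eq_bigr => i _; rewrite tnth_mktuple.
Qed.

Lemma sample_mean_prod (rho : pos -> R) : (forall p, 0 <= rho p) ->
  (sample_mean (fun N x => (\prod_(t < N) rho (tnth x t))%:E) =
   (expR (lam * \sum_p (rho p - 1)))%:E)%E.
Proof.
move=> rho0; have nd0 : (0 < (n * d)%:R :> R) by rewrite ltr0n muln_gt0 n0.
rewrite /sample_mean.
transitivity (\int[poisson_prob (lam * n%:R * d%:R) 0]_N
    (((\sum_p rho p) / (n * d)%:R) ^+ N)%:E)%E.
  apply: eq_integral => N _; under eq_bigr do rewrite -EFinM.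
  rewrite sumEFin -mulr_sumr sum_tuple_prod prodr_const card_ord.
  by rewrite exprMn mulrC.
rewrite integral_poisson_pow; last 2 first.
- by rewrite !mulr_gt0// ltr0n.
- by apply: divr_ge0; [exact: sumr_ge0|exact: ltW].
congr (expR _)%:E; rewrite sumrB sumr_const card_prod !card_ord natrM.
have n1 : (n%:R : R) != 0 by rewrite pnatr_eq0 -lt0n.
have d1 : (d%:R : R) != 0 by rewrite pnatr_eq0 -lt0n.
by field; rewrite n1 d1.
Qed.

Lemma sample_mean1 : sample_mean (fun N x => 1%E) = 1%E.
Proof.
have h := @sample_mean_prod (fun=> 1) (fun=> ler01).
rewrite [X in lam * X]big1 ?mulr0 ?expR0 in h; last by move=> p _; rewrite subrr.
apply: etrans h; apply: eq_sample_mean => N x.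
by rewrite /= big1_eq.
Qed.

End SampleMean.

Section Reduction.
Context (R : realType) (n d : nat) (lam zeta : R).
Hypotheses (lam0 : 0 < lam) (n0 : (0 < n)%N) (d0 : (0 < d)%N).
Local Notation pos := ('I_n * 'I_d)%type.
Local Notation T := (measurableTypeR R).

Definition data_law (M : 'M[R]_(n, d)) N (x : N.-tuple pos) : probability (N.-tuple T) R :=
  product_law (fun t => gauss_law (M (tnth x t).1 (tnth x t).2) zeta).

Definition event := forall N, N.-tuple pos -> set (N.-tuple T).

Definition measurable_event (S : event) := forall N x, measurable (S N x).

Definition event_prob (M : 'M[R]_(n, d)) (S : event) : R :=
  fine (sample_mean lam (fun N x => data_law M x (S N x))).

Lemma event_probE M (S : event) : measurable_event S ->
  sample_mean lam (fun N x => data_law M x (S N x)) = (event_prob M S)%:E.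
Proof.
move=> mS; rewrite fineK//; apply/fin_real/andP; split.
  by apply: lt_le_trans (ltNy0) _; apply: sample_mean_ge0 => N x; exact: measure_ge0.
apply: le_lt_trans (ltry 1); rewrite -(sample_mean1 lam0 n0 d0).
apply: le_sample_mean => N x; first exact: measure_ge0.
by apply: probability_le1; exact: mS.
Qed.

Lemma event_prob_ge0 M (S : event) : 0 <= event_prob M S.
Proof.
by apply: fine_ge0; apply: sample_mean_ge0 => N x; exact: measure_ge0.
Qed.

Variable est : estimator_fun R n d.
Hypothesis mest : is_estimator est.

Definition est_event (Q : pred 'S_n) : event := fun N x => [set y | Q (est x y)].

Lemma measurable_est_event Q : measurable_event (est_event Q).
Proof.
move=> N x.
rewrite (_ : est_event Q x = \big[setU/set0]_(s' | Q s') [set y | est x y = s']).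
  by apply: bigsetU_measurable => s' _; exact: mest.
apply/seteqP; split => y /=.
  by move=> Qy; rewrite (bigD1 (est x y)) //=; left.
apply: (big_ind (fun U : set _ => U y -> Q (est x y))) => [//|U W IU IW|s' Qs' /= -> //].
by case=> [/IU|/IW].
Qed.

Lemma risk_ge (s : 'S_n) (M : 'M[R]_(n, d)) (K : finType) (c : K -> R) (Q : K -> pred 'S_n) :
  (forall k, 0 <= c k) ->
  (forall s', \sum_k c k * (Q k s')%:R <= frobenius2 (relabel s' M - relabel s M)) ->
  ((\sum_k c k * event_prob M (est_event (Q k)))%:E <= risk lam zeta est s M)%E.
Proof.
move=> c0 cQ.
have mS k := measurable_est_event (Q k).
have -> : (\sum_k c k * event_prob M (est_event (Q k)))%:E =
    sample_mean lam (fun N x => \sum_k (c k)%:E * data_law M x (est_event (Q k) x))%E.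
  rewrite sample_mean_sum// -sumEFin; apply: eq_bigr => k _.
  by rewrite event_probE ?EFinM//; exact: mS.
apply: le_sample_mean => N x.
  by apply: sume_ge0 => k _; apply: mule_ge0; [rewrite lee_fin|exact: measure_ge0].
have m1 (S : set (N.-tuple T)) : measurable S -> measurable_fun setT (\1_S : _ -> R).
  by move=> ?; exact: measurable_indic.
pose f y : R := \sum_k c k * \1_(est_event (Q k) x) y.
have fE : (\int[data_law M x]_y (f y)%:E =
    \sum_k (c k)%:E * data_law M x (est_event (Q k) x))%E.
  rewrite ge0_integral_EFin_sum//; last by move=> k; apply: m1; exact: mS.
  apply: eq_bigr => k _; congr *%E; apply: integral_EFin_indic; exact: mS.
rewrite -fE; apply: ge0_le_integral_EFin.
- by apply: measurable_sum => k; apply: measurable_funM => //; apply: m1; exact: mS.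
- rewrite (_ : (fun _ => _) = fun y => \sum_(s' : 'S_n) (frobenius2 (relabel s' M - relabel s M)) *
      \1_[set y | est x y = s'] y).
    by apply: measurable_sum => s'; apply: measurable_funM => //; apply: m1; exact: mest.
  apply/funext => y; rewrite (bigD1 (est x y))//= indicE mem_set//= mulr1 big1 ?addr0// => s' s'y.
  by rewrite indicE memNset ?mulr0//= => /esym/eqP; apply/negP.
- by move=> y; apply: sumr_ge0 => k _; rewrite mulr_ge0// indicE.
move=> y; apply: le_trans (cQ (est x y)); apply: ler_sum => k _.
rewrite ler_wpM2l// indicE ler_nat; case: (boolP (y \in _)) => // /set_mem /=.
by rewrite /est_event /= => ->.
Qed.

End Reduction.

(** * Reduction to tests between paired rows *)

(* [cell i j] is the switch controlling the entry [(i, j)], [act i] says that the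
   row [i] has a partner [sg i], exactly one of the two being [good], that is,
   shifted where the switches are on. A position [k] of the estimated row is on
   the wrong side for [i] when [good i = ~~ up i k]. *)
Section Design.
Context (R : realType) (n d : nat) (lam zeta : R).
Hypotheses (lam0 : 0 < lam) (n0 : (0 < n)%N) (d0 : (0 < d)%N).
Local Notation pos := ('I_n * 'I_d)%type.
Local Notation T := (measurableTypeR R).
Variables (I : finType) (base : 'I_n -> 'I_d -> R) (cell : 'I_n -> 'I_d -> option I).
Variables (good act : pred 'I_n) (sg : 'I_n -> 'I_n) (up : 'I_n -> pred 'I_n) (h th : R).
Implicit Types (e : {ffun I -> bool}) (s : 'S_n) (i : 'I_n) (j : 'I_d).

Definition lit i j e : bool := if cell i j is Some b then e b else false.

Definition pattern e : 'M[R]_(n, d) :=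
  \matrix_(i, j) (base i j + if good i && lit i j e then h else 0).

Definition signal s e : 'M[R]_(n, d) := row_perm s (pattern e).

(* The probabilities of the switches conditionally on [b] being on. *)
Definition raise (b c : I) : R := if c == b then 1 else th.

Hypothesis h0 : 0 <= h.
Hypothesis th01 : 0 <= th <= 1.
Hypothesis pattern_biso : forall e, biso (pattern e).
Hypothesis sgK : involutive sg.
Hypothesis act_sg : forall i, act (sg i) = act i.
Hypothesis good_sg : forall i, act i -> good (sg i) = ~~ good i.
Hypothesis cell_sg : forall i j, cell (sg i) j = cell i j.
Hypothesis up_sg : forall i k, up (sg i) k = up i k.
Hypothesis gap : forall e i j k, act i -> lit i j e -> good i = ~~ up i k ->
  h <= `|pattern e i j - pattern e k j|.

Let err i k := good i == ~~ up i k.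

Lemma relabel_signal s e : relabel s (signal s e) = pattern e.
Proof. by rewrite /relabel /signal -row_permM mulVg row_perm1. Qed.

Lemma frobenius2_signal_ge s s' e :
  \sum_i (h ^+ 2 * \sum_j (act i && lit i j e)%:R) * (err i (s' (s^-1%g i)))%:R <=
  frobenius2 (relabel s' (signal s e) - relabel s (signal s e)).
Proof.
rewrite relabel_signal /frobenius2.
rewrite [leRHS](reindex_inj (@perm_inj _ (s^-1 * s')%g)) /=.
apply: ler_sum => i _; rewrite mulr_sumr mulr_suml; apply: ler_sum => j _.
have -> : (relabel s' (signal s e) - pattern e) ((s^-1 * s')%g i) j =
    pattern e i j - pattern e (s' (s^-1%g i)) j.
  by rewrite /relabel /signal !mxE !permM permK permKV.
have [/andP[ai lij]|_] := boolP (act i && lit i j e); last first.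
  by rewrite mulr0 mul0r sqr_ge0.
have [/eqP ei|_] := boolP (err _ _); last by rewrite mulr0 sqr_ge0.
rewrite !mulr1 -[leRHS]real_normK ?num_real//.
by apply: lerXn2r; rewrite ?nnegrE//; exact: gap.
Qed.

Lemma bernw_raise b e : bernw (fun=> th) e * (e b)%:R = th * bernw (raise b) e.
Proof.
rewrite /bernw (bigD1 b)//= [in RHS](bigD1 b)//= /raise eqxx.
case: (e b); rewrite ?mulr0 ?subrr ?mul0r ?mulr0// mulr1 mul1r; congr *%R.
by apply: eq_bigr => c /negbTE ->.
Qed.

Lemma raise01 b c : 0 <= raise b c <= 1.
Proof. by rewrite /raise; case: ifP => // _; rewrite ler01 lexx. Qed.

Definition pair_error s i b (S : event R n d) : R :=
  \sum_e bernw (raise b) e * (event_prob lam zeta (signal s e) S +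
    event_prob lam zeta (signal (s * tperm i (sg i))%g e) (fun N x => ~` S N x)).

(* The transposition of [i] and [sg i] pairs the permutations, and within a pair
   the events "the row [i] is misplaced" and "the row [sg i] is misplaced" are
   complementary. *)
Lemma minimax_ge_pair_error (c : R) : 0 <= c ->
  (forall s i j b S, act i -> cell i j = Some b -> measurable_event S ->
    c <= pair_error s i b S) ->
  ((h ^+ 2 / 2 * th * c * \sum_i \sum_j (act i && (cell i j != None))%:R)%:E <=
   minimax_risk n d lam zeta)%E.
Proof.
move=> c0 test; apply: le_ereal_inf_tmp => _ [est mest ->].
set sup := ereal_sup _.
have [t0 t1] := andP th01.
have w0 e : 0 <= bernw (fun=> th) e by apply: bernw_ge0.
pose Q s i := [pred s' : 'S_n | err i (s' (s^-1%g i))].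
pose q s e i := event_prob lam zeta (signal s e) (est_event est (Q s i)).
have q0 s e i : 0 <= q s e i by exact: event_prob_ge0.
pose a s e := \sum_i (h ^+ 2 * \sum_j (act i && lit i j e)%:R) * q s e i.
have a0 s e : 0 <= a s e.
  by apply: sumr_ge0 => i _; do 2 apply: mulr_ge0 => //; rewrite ?sqr_ge0// sumr_ge0.
have a_le s e : ((a s e)%:E <= sup)%E.
  apply: le_trans (ereal_sup_ubound _); last first.
    by exists (s, signal s e) => //=; rewrite relabel_signal; exact: pattern_biso.
  apply: (@risk_ge _ _ _ lam zeta lam0 n0 d0 est mest s (signal s e) _ _ (Q s)) => [i|s'].
    by apply: mulr_ge0; rewrite ?sqr_ge0// sumr_ge0.
  exact: frobenius2_signal_ge.
have fact0 : 0 < (n`!%:R : R) by rewrite ltr0n fact_gt0.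
pose avg := n`!%:R^-1 * \sum_s \sum_e bernw (fun=> th) e * a s e.
apply: (@le_trans _ _ avg%:E); last first.
  move: a_le; case: sup => [r| |] a_le; last first.
  - by have := a_le 1%g [ffun=> true]; rewrite leeNy_eq.
  - exact: leey.
  rewrite lee_fin /avg mulrC ler_pdivrMr//.
  have -> : r * n`!%:R = \sum_(s : 'S_n) \sum_(e : {ffun I -> bool}) bernw (fun=> th) e * r.
    under eq_bigr do rewrite -mulr_suml sum_bernw mul1r.
    by rewrite sumr_const card_Sn mulr_natr.
  apply: ler_sum => s _; apply: ler_sum => e _.
  by apply: ler_wpM2l => //; rewrite -lee_fin.
pose f s i := \sum_j \sum_b (act i && (cell i j == Some b))%:R *
  \sum_e bernw (raise b) e * q s e i.
have avgE : avg = n`!%:R^-1 * (h ^+ 2 * th) * \sum_s \sum_i f s i.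
  rewrite /avg -mulrA; congr *%R; rewrite mulr_sumr; apply: eq_bigr => s _.
  transitivity (\sum_i \sum_e bernw (fun=> th) e *
      ((h ^+ 2 * \sum_j (act i && lit i j e)%:R) * q s e i)).
    by rewrite exchange_big; apply: eq_bigr => e _; rewrite mulr_sumr.
  rewrite mulr_sumr; apply: eq_bigr => i _.
  transitivity (\sum_j \sum_e bernw (fun=> th) e * (h ^+ 2 * (act i && lit i j e)%:R * q s e i)).
    rewrite exchange_big; apply: eq_bigr => e _.
    by rewrite mulr_sumr mulr_suml mulr_sumr.
  rewrite /f mulr_sumr; apply: eq_bigr => j _.
  case: (act i) => /=; last first.
    by rewrite !big1 ?mulr0// => t _; rewrite ?mulr0n !(mulr0, mul0r).
  rewrite /lit; case: (cell i j) => [b|]; last first.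
    by rewrite !big1 ?mulr0// => t _; rewrite ?mulr0n !(mulr0, mul0r).
  rewrite (bigD1 b)//= eqxx mul1r [X in _ + X]big1 ?addr0; last first.
    move=> b' b'b; rewrite (_ : (Some b == Some b') = false) ?mul0r//.
    by apply/negbTE; apply: contra b'b => /eqP[->].
  rewrite mulr_sumr; apply: eq_bigr => e _.
  transitivity (h ^+ 2 * (bernw (fun=> th) e * (e b)%:R) * q s e i); first by ring.
  by rewrite bernw_raise; ring.
have paired : \sum_s \sum_i f s i =
    2^-1 * \sum_i \sum_s (f s i + f (s * tperm i (sg i))%g (sg i)).
  have e1 : \sum_s \sum_i f s i = \sum_i \sum_s f s i by rewrite exchange_big.
  have e2 : \sum_s \sum_i f s i = \sum_i \sum_s f (s * tperm i (sg i))%g (sg i).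
    rewrite exchange_big [LHS](reindex_inj (inv_inj sgK)) /=; apply: eq_bigr => i _.
    by rewrite (reindex_inj (mulIg (tperm i (sg i)))).
  transitivity (2^-1 * (\sum_s \sum_i f s i + \sum_s \sum_i f s i)); first by field.
  by rewrite {1}e1 e2 -big_split; congr *%R; apply: eq_bigr => i _; rewrite big_split.
rewrite lee_fin avgE paired.
have main i : n`!%:R * (c * \sum_j (act i && (cell i j != None))%:R) <=
    \sum_s (f s i + f (s * tperm i (sg i))%g (sg i)).
  have -> : n`!%:R * (c * \sum_j (act i && (cell i j != None))%:R) =
     \sum_(s : 'S_n) (c * \sum_j (act i && (cell i j != None))%:R).
    by rewrite sumr_const card_Sn mulr_natl.
  apply: ler_sum => s _; rewrite /f -big_split mulr_sumr; apply: ler_sum => j _ /=.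
  rewrite -big_split /=.
  have [ai|nai] /= := boolP (act i); last first.
    rewrite mulr0; apply: sumr_ge0 => b _.
    by rewrite act_sg (negbTE nai) /= !mul0r addr0.
  case Eij : (cell i j) => [b|]; last first.
    rewrite mulr0; apply: sumr_ge0 => b _.
    by rewrite cell_sg Eij /= andbF !mul0r addr0.
  rewrite mulr1 (bigD1 b)//= eqxx act_sg ai cell_sg Eij eqxx !mul1r.
  apply: (@le_trans _ _ (pair_error s i b (est_event est (Q s i)))).
    by apply: (test s i j b _ ai Eij); exact: measurable_est_event.
  rewrite -[leLHS]addr0; apply: lerD; last first.
    apply: sumr_ge0 => b' _; apply: addr_ge0; apply: mulr_ge0 => //;
      by apply: sumr_ge0 => e _; apply: mulr_ge0 => //; apply: bernw_ge0 => k; exact: raise01.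
  rewrite -big_split /= le_eqVlt; apply/orP; left; apply/eqP.
  apply: eq_bigr => e _; rewrite -mulrDr; congr (_ * (_ + _)).
  rewrite /q /event_prob; congr fine; apply: eq_sample_mean => N x; congr (_ _).
  apply/seteqP; split => y /=; rewrite /est_event /= /Q /= /err.
    rewrite invMg permM tpermV tpermR up_sg (good_sg ai).
    by case: (good i); case: (up _ _).
  rewrite invMg permM tpermV tpermR up_sg (good_sg ai).
  by case: (good i); case: (up _ _).
have -> : n`!%:R^-1 * (h ^+ 2 * th) * (2^-1 * \sum_i \sum_s (f s i + f (s * tperm i (sg i))%g (sg i)))
   = h ^+ 2 / 2 * th * (n`!%:R^-1 * \sum_i \sum_s (f s i + f (s * tperm i (sg i))%g (sg i))).
  by ring.
rewrite -[leLHS]mulrA; apply: ler_wpM2l; first by rewrite mulr_ge0// mulr_ge0// sqr_ge0.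
rewrite (mulrC n`!%:R^-1) ler_pdivlMr// mulrC !mulr_sumr.
apply: ler_sum => i _; apply: le_trans (main i).
by rewrite mulr_sumr.
Qed.

End Design.

Section Counts.
Context (R : realType) (n d : nat) (lam : R).
Hypotheses (lam0 : 0 < lam) (n0 : (0 < n)%N) (d0 : (0 < d)%N).
Local Notation pos := ('I_n * 'I_d)%type.

Lemma expR_count N (x : N.-tuple pos) (P : pred pos) (a : R) :
  expR (a * #|[pred t | P (tnth x t)]|%:R) =
  \prod_(t < N) (if P (tnth x t) then expR a else 1).
Proof.
rewrite -big_mkcond /= prodr_const (mulrC a) expRM_natl.
by congr (_ ^+ _); apply: eq_card => t; rewrite !inE.
Qed.

Lemma sample_mean_expR_count (P : pred pos) (a : R) :
  sample_mean lam (fun N (x : N.-tuple pos) =>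
    (expR (a * #|[pred t | P (tnth x t)]|%:R))%:E) =
  (expR (lam * (expR a - 1) * #|P|%:R))%:E.
Proof.
have e0 p : 0 <= if P p then expR a else 1 by case: ifP => // _; exact: expR_ge0.
have := sample_mean_prod lam0 n0 d0 e0.
rewrite (_ : \sum_p _ = (expR a - 1) * #|P|%:R); last first.
  under eq_bigr do rewrite -[X in _ - X]/1 (fun_if (fun z => z - 1)) subrr.
  by rewrite -big_mkcond /= sumr_const mulr_natr.
rewrite mulrA => <-; apply: eq_sample_mean => N x; congr (_%:E).
exact: expR_count.
Qed.

Lemma sample_mean_expR_countB (P1 P2 : pred pos) (a : R) : 0 <= a ->
  (forall p, ~~ (P1 p && P2 p)) ->
  sample_mean lam (fun N (x : N.-tuple pos) =>
    ((expR (a * #|[pred t | P1 (tnth x t)]|%:R) - 1) *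
      expR (a * #|[pred t | P2 (tnth x t)]|%:R))%:E) =
  ((expR (lam * (expR a - 1) * #|P1|%:R) - 1) *
    expR (lam * (expR a - 1) * #|P2|%:R))%:E.
Proof.
move=> a0 P12.
pose g N (x : N.-tuple pos) := (expR (a * #|[pred t | P1 (tnth x t)]|%:R) - 1) *
      expR (a * #|[pred t | P2 (tnth x t)]|%:R).
have g0 N (x : N.-tuple pos) : 0 <= g N x.
  by rewrite mulr_ge0 ?expR_ge0// subr_ge0 -[leLHS]expR0 ler_expR mulr_ge0.
have PU : #|predU P1 P2| = (#|P1| + #|P2|)%N.
  rewrite -cardUI [X in (_ + X)%N]eq_card0 ?addn0// => p.
  by rewrite !inE; apply: negbTE; exact: P12.
have E : (sample_mean lam (fun N (x : N.-tuple pos) => (g N x)%:E) +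
    (expR (lam * (expR a - 1) * #|P2|%:R))%:E =
    (expR (lam * (expR a - 1) * #|predU P1 P2|%:R))%:E)%E.
  rewrite -(sample_mean_expR_count P2 a) -(sample_mean_expR_count (predU P1 P2) a).
  rewrite -sample_meanD => [|N x|N x]; last 2 first.
  - by rewrite lee_fin.
  - by rewrite lee_fin expR_ge0.
  apply: eq_sample_mean => N x; rewrite -EFinD /g; congr (_%:E).
  have -> : #|[pred t | predU P1 P2 (tnth x t)]| =
      (#|[pred t | P1 (tnth x t)]| + #|[pred t | P2 (tnth x t)]|)%N.
    rewrite -cardUI [X in (_ + X)%N]eq_card0 ?addn0// => t.
    by rewrite !inE; apply: negbTE; exact: P12.
  by rewrite natrD mulrDr expRD; ring.
rewrite PU natrD (mulrDr (lam * (expR a - 1))) expRD in E.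
apply: (@etrans _ _ (sample_mean lam (fun N (x : N.-tuple pos) => (g N x)%:E))) => //.
move: E; case: (sample_mean _ _) => // r [E]; congr (_%:E).
by rewrite mulrBl mul1r -E addrK.
Qed.

End Counts.

Section Tests.
Context (R : realType) (n d : nat) (lam zeta : R).
Hypotheses (lam0 : 0 < lam) (n0 : (0 < n)%N) (d0 : (0 < d)%N).
Local Notation pos := ('I_n * 'I_d)%type.
Local Notation T := (measurableTypeR R).
Variables (I : finType) (base : 'I_n -> 'I_d -> R) (cell : 'I_n -> 'I_d -> option I).
Variables (good act : pred 'I_n) (sg : 'I_n -> 'I_n) (h th : R).
Implicit Types (e : {ffun I -> bool}) (s : 'S_n) (i : 'I_n) (j : 'I_d).
Hypothesis th01 : 0 <= th <= 1.
Hypothesis good_sg : forall i, act i -> good (sg i) = ~~ good i.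
Hypothesis cell_sg : forall i j, cell (sg i) j = cell i j.
Hypothesis base_sg : forall i j, base (sg i) j = base i j.

Local Notation signal := (signal base cell good h).
Local Notation pair_error := (pair_error lam zeta base cell good sg h th).

Lemma signalE s e (p : pos) : signal s e p.1 p.2 =
  base (s p.1) p.2 + if good (s p.1) && lit cell (s p.1) p.2 e then h else 0.
Proof. by rewrite /signal !mxE. Qed.

Lemma eq_data_law (M M' : 'M[R]_(n, d)) N (x : N.-tuple pos) :
  (forall t, M (tnth x t).1 (tnth x t).2 = M' (tnth x t).1 (tnth x t).2) ->
  data_law zeta M x = data_law zeta M' x.
Proof.
move=> MM'; apply: (congr1 (@product_law _ T R N)); apply/funext => t.
exact: (congr1 (fun m => gauss_law m zeta) (MM' t)).
Qed.

Lemma event_prob_pairE s s' e e' (S : event R n d) : measurable_event S ->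
  (event_prob lam zeta (signal s e) S +
    event_prob lam zeta (signal s' e') (fun N x => ~` S N x))%:E =
  sample_mean lam (fun N x => data_law zeta (signal s e) x (S N x) +
    data_law zeta (signal s' e') x (~` S N x))%E.
Proof.
move=> mS; have mSC : measurable_event (fun N x => ~` S N x).
  by move=> N x; apply: measurableC; exact: mS.
rewrite EFinD -!event_probE//.
rewrite -sample_meanD// => N x; exact: measure_ge0.
Qed.

Lemma card_rows s i (c : pred (option I)) :
  (#|[pred p : pos | (s p.1 \in [:: i; sg i]) && c (cell (s p.1) p.2)]| <=
  2 * #|[pred j | c (cell i j)]|)%N.
Proof.
set k := #|[pred j | c (cell i j)]|.
rewrite -sum1_card big_mkcond /=.
rewrite (eq_bigr (fun p : pos => if (s p.1 \in [:: i; sg i]) && c (cell (s p.1) p.2)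
  then 1 else 0)%N)//.
rewrite -(pair_big xpredT xpredT (fun r j =>
  if (s r \in [:: i; sg i]) && c (cell (s r) j) then 1 else 0)%N) /=.
rewrite (reindex_inj (@perm_inj _ s^-1%g)) /=.
apply: (@leq_trans (\sum_(i' in [:: i; sg i]) k)); last first.
  by rewrite sum_nat_const leq_mul2r card_size orbT.
rewrite [leqRHS]big_mkcond /=; apply: leq_sum => i' _; rewrite permKV.
case: ifPn => [|ni']; last by rewrite big1// => j _; rewrite (negbTE ni').
rewrite !inE => /orP i'E; rewrite -big_mkcond /= sum1_card.
apply/subset_leq_card/fintype.subsetP => j.
by case: i'E => /eqP ->; rewrite !unfold_in /= ?cell_sg.
Qed.

(* When the two rows are not observed at switched cells, the sample has the same
   law under both hypotheses. *)
Lemma pair_error_erasure s i b (S : event R n d) : act i -> measurable_event S ->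
  expR (- (2 * lam * #|[pred j | cell i j != None]|%:R)) <= pair_error s i b S.
Proof.
move=> ai mS; set w := #|_|.
pose s' := (s * tperm i (sg i))%g.
pose P := [pred p : pos | (s p.1 \in [:: i; sg i]) && (cell (s p.1) p.2 != None)].
suff key e : expR (- (2 * lam * w%:R)) <= event_prob lam zeta (signal s e) S +
    event_prob lam zeta (signal s' e) (fun N x => ~` S N x).
  move: key; set E := expR _ => key.
  rewrite -[leLHS]mul1r -(sum_bernw (raise th b)) mulr_suml.
  apply: ler_sum => e _; apply: ler_wpM2l; last exact: key.
  by apply: bernw_ge0 => c; exact: raise01.
pose rho (p : pos) : R := if P p then 0 else 1.
have rho0 p : 0 <= rho p by rewrite /rho; case: ifP.
rewrite -lee_fin event_prob_pairE//.
apply: (@le_trans _ _ (sample_mean lam (fun N (x : N.-tuple pos) =>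
    (\prod_(t < N) rho (tnth x t))%:E))).
  rewrite sample_mean_prod// lee_fin ler_expR.
  have -> : \sum_p (rho p - 1) = - #|P|%:R.
    transitivity (\sum_p (if P p then - 1 else 0 : R)).
      by apply: eq_bigr => p _; rewrite /rho; case: ifP; rewrite ?subrr ?sub0r.
    by rewrite -big_mkcond /= sumr_const mulNrn.
  rewrite mulrN lerN2 (mulrC 2) -mulrA; apply: ler_wpM2l; first exact: ltW.
  have := card_rows s i (fun c => c != None).
  by rewrite -(ler_nat R) natrM.
apply: le_sample_mean => N x; first by rewrite lee_fin prodr_ge0.
have [clean|] := boolP [forall t, ~~ P (tnth x t)]; last first.
  rewrite negb_forall => /existsP[t]; rewrite negbK => Pt.
  by rewrite (bigD1 t)//= /rho Pt mul0r adde_ge0.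
have -> : data_law zeta (signal s' e) x = data_law zeta (signal s e) x.
  apply: eq_data_law => t; have /forallP/(_ t) := clean; rewrite !signalE /P inE /= !inE permM.
  set p := tnth x t; case: tpermP => [->|->|]; rewrite ?eqxx ?orbT //= negbK => /eqP ce.
    by rewrite /lit cell_sg ce base_sg !andbF.
  by rewrite /lit -cell_sg ce -base_sg !andbF.
rewrite big1; last by move=> t _; rewrite /rho ifN//; exact: (forallP clean).
rewrite (probability_setC (data_law zeta (signal s e) x) (mS N x)) addeC subeK//.
by apply: fin_num_measure; exact: mS.
Qed.

Hypothesis zeta0 : zeta != 0.
Local Notation A := (h ^+ 2 / zeta ^+ 2).

Lemma pair_error_chi2 s i b (S : event R n d) (q L Q : nat) (tau : R) :
  act i -> measurable_event S ->
  (th <= 2^-1 \/ th = 1) ->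
  (forall c, #|[pred j | cell i j == Some c]| <= q)%N ->
  (forall c, #|[pred p : pos | good p.1 && (cell p.1 p.2 == Some c)]| <= L)%N ->
  (#|[pred c | [exists j, cell i j == Some c]]| <= Q)%N ->
  (if th == 1 then 1 else 2 * th ^+ 2 * expR (lam * (expR A - 1) * L%:R)) <= tau ->
  (expR (lam * (expR A - 1) * (2 * q)%:R) - 1) * (1 + Q%:R * tau) <= 24^-1 ->
  2^-1 <= pair_error s i b S.
Proof.
move=> ai mS thP qP LP QP tauP small.
pose u := lam * (expR A - 1).
have A0 : 0 <= A by rewrite divr_ge0// sqr_ge0.
have u0 : 0 <= u.
  by apply: mulr_ge0; [exact: ltW|rewrite subr_ge0 -[leLHS]expR0 ler_expR].
pose ig := if good i then i else sg i.
pose ib := if good i then sg i else i.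
have gig : good ig by rewrite /ig; case: ifP => // gi; rewrite good_sg// gi.
have gib : good ib = false by rewrite /ib; case: ifP => // gi; rewrite good_sg// gi.
have igb : ig != ib by apply/eqP => E; rewrite E gib in gig.
have cig j : cell ig j = cell i j by rewrite /ig; case: ifP => // _; exact: cell_sg.
have cib j : cell ib j = cell i j by rewrite /ib; case: ifP => // _; exact: cell_sg.
have big_ j : base ig j = base i j by rewrite /ig; case: ifP => // _; exact: base_sg.
have bib j : base ib j = base i j by rewrite /ib; case: ifP => // _; exact: base_sg.
have tig : tperm i (sg i) ig = ib by rewrite /ig /ib; case: ifP; rewrite ?tpermL ?tpermR.
have tib : tperm i (sg i) ib = ig by rewrite /ig /ib; case: ifP; rewrite ?tpermL ?tpermR.
have tne k : k != ig -> k != ib -> tperm i (sg i) k = k.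
  rewrite /ig /ib; case: ifP => _ k1 k2; rewrite tpermD// eq_sym//.
pose two := [pred p : pos | (s p.1 == ig) || (s p.1 == ib)].
pose blk (p : pos) := if good (s p.1) || (s p.1 == ib) then cell (s p.1) p.2 else None.
pose s' := (s * tperm i (sg i))%g.
pose P1 c := [pred p : pos | two p && (blk p == Some c)].
pose P2 c := [pred p : pos | ~~ two p && (blk p == Some c)].
have P1card c : (#|P1 c| <= 2 * q)%N.
  apply: leq_trans (leq_mul (leqnn 2) (qP c)).
  apply: leq_trans (card_rows s i (fun o => o == Some c)).
  apply/subset_leq_card/fintype.subsetP => -[r j]; rewrite !inE /= /blk /=.
  rewrite /ig /ib; case: (good i); case/andP => /orP[]/eqP -> ; rewrite ?eqxx ?orbT //=;
    by case: ifP.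
have P2card c : (#|P2 c| <= L)%N.
  apply: leq_trans (LP c).
  have inj : injective (fun p : pos => (s p.1, p.2)) by move=> [a a'] [a1 a2] [/perm_inj -> ->].
  rewrite -(fintype.card_image inj); apply/subset_leq_card/fintype.subsetP => p.
  move=> /fintype.imageP[[r j]]; rewrite !inE /= /blk /= negb_or => /andP[/andP[_ rib]].
  rewrite (negbTE rib) orbF; case gr: (good _) => // /eqP ce ->.
  by rewrite /= gr ce eqxx.
pose K := expR (u * (2 * q)%:R) - 1.
have K0 : 0 <= K by rewrite subr_ge0 -[leLHS]expR0 ler_expR mulr_ge0.
pose used c := [exists j, cell i j == Some c].
have P1K c : expR (u * #|P1 c|%:R) - 1 <= K * (used c)%:R.
  case: (boolP (used c)) => [_|nu].
    by rewrite mulr1 /K lerD2r ler_expR; apply: ler_wpM2l => //; rewrite ler_nat.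
  rewrite eq_card0 ?mulr0 ?expR0 ?subrr// => p; rewrite !inE /= /blk.
  apply/negbTE/negP => /andP[tp]; move: nu; rewrite negb_exists => /forallP/(_ p.2)/negP.
  by case/orP: tp => /eqP ->; rewrite ?cig ?cib; case: ifP.
pose T1 N (x : N.-tuple pos) : pred 'I_N := fun t => s (tnth x t).1 == ig.
pose T2 N (x : N.-tuple pos) : pred 'I_N := fun t => s (tnth x t).1 == ib.
pose mu N (x : N.-tuple pos) t := base (s (tnth x t).1) (tnth x t).2.
pose bl N (x : N.-tuple pos) t := blk (tnth x t).
pose bb N (x : N.-tuple pos) c := block_bound zeta h (bl N x) (T1 N x) (T2 N x) (raise th b) c.
pose g c N (x : N.-tuple pos) :=
  (expR (A * (block_count (bl N x) (predU (T1 N x) (T2 N x)) c)%:R) - 1) * bb N x c.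
have T12 N (x : N.-tuple pos) t : ~~ (T1 N x t && T2 N x t).
  by apply/negP => /andP[/eqP E1 /eqP E2]; rewrite -E1 -E2 eqxx in igb.
have raiseP c : raise th b c <= 2^-1 \/ raise th b c = 1.
  by rewrite /raise; case: ifP => _; [right|].
have test N (x : N.-tuple pos) : ((3 / 4)%:E <= \sum_e (bernw (raise th b) e)%:E *
     (data_law zeta (signal s e) x (S N x) + data_law zeta (signal s' e) x (~` S N x)) +
     (6 * \sum_c g c N x)%:E)%E.
  have := @mixture_test R I N (mu N x) zeta h (bl N x) zeta0 (T1 N x) (T2 N x)
    (raise th b) (raise01 th01 b) raiseP (@T12 N x) (S N x) (mS N x).
  move=> /le_trans; apply; apply: leeD; last exact: lexx.
  have eq_term (w a a' c c' : \bar R) : a = a' -> c = c' ->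
      (w * (a + c) <= w * (a' + c'))%E by move=> -> ->.
  apply: lee_sum => e _; apply: eq_term.
    apply: (congr1 (fun P : probability _ _ => P (S N x))).
    apply: (congr1 (@product_law _ T R N)); apply/funext => t.
    apply: (congr1 (fun m => gauss_law m zeta)); apply: esym.
    rewrite signalE; congr (_ + _).
    rewrite /shift /switched /bl /blk /T2 /lit /=.
    have [E|_] /= := eqVneq (s (tnth x t).1) ib; first by rewrite E gib.
    by rewrite orbF; case: (good _).
  apply: (congr1 (fun P : probability _ _ => P (~` S N x))).
  apply: (congr1 (@product_law _ T R N)); apply/funext => t.
  apply: (congr1 (fun m => gauss_law m zeta)); apply: esym.
  rewrite signalE permM /shift /switched /bl /blk /T1 /mu /lit /=.
  have [E|r1] /= := eqVneq (s (tnth x t).1) ig.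
    by rewrite E tig gib /= bib big_.
  have [E|r2] /= := eqVneq (s (tnth x t).1) ib.
    by rewrite E tib gig orbT /= bib big_ cig cib.
  by rewrite tne// orbF; case: (good _).
have bb0 N (x : N.-tuple pos) c : 0 <= bb N x c.
  rewrite /bb /block_bound; case: (_ == 1) => //.
  by apply: mulr_ge0; [apply: mulr_ge0 => //; exact: sqr_ge0|exact: expR_ge0].
have g0 c N (x : N.-tuple pos) : 0 <= g c N x.
  by apply: mulr_ge0 => //; rewrite subr_ge0 -[leLHS]expR0 ler_expR mulr_ge0.
have mean_g c : (sample_mean lam (fun N x => (g c N x)%:E) <=
    (K * (used c)%:R * (if c == b then 1 else tau))%:E)%E.
  have -> : sample_mean lam (fun N x => (g c N x)%:E) =
      ((if raise th b c == 1 then 1 else 2 * raise th b c ^+ 2)%:E *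
       sample_mean lam (fun N (x : N.-tuple pos) =>
         ((expR (A * #|[pred t | P1 c (tnth x t)]|%:R) - 1) *
         expR (A * #|[pred t | (if raise th b c == 1 then pred0 else P2 c) (tnth x t)]|%:R))%:E))%E.
    rewrite -sample_meanZ; last 2 first.
    - by case: ifP => // _; rewrite mulr_ge0 ?sqr_ge0.
    - move=> N x; rewrite lee_fin; apply: mulr_ge0; last exact: expR_ge0.
      by rewrite subr_ge0 -[leLHS]expR0 ler_expR mulr_ge0.
    apply: eq_sample_mean => N x; rewrite -EFinM /g /bb /block_bound; congr (_%:E).
    case: (_ == 1).
      have -> : #|[pred t | @pred0 pos (tnth x t)]| = 0%N by exact: eq_card0.
      by rewrite mulr0 expR0 !mulr1 mul1r.
    by rewrite mulrCA.
  rewrite sample_mean_expR_countB//; last first.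
    move=> p; apply/negP => /andP[/andP[tp _]]; case: (_ == 1) => //= /andP[].
    by move: tp; rewrite /= => ->.
  rewrite -EFinM lee_fin -/u.
  have K1 : 0 <= expR (u * #|P1 c|%:R) - 1 by rewrite subr_ge0 -[leLHS]expR0 ler_expR mulr_ge0.
  have le_mul (C C' : R) : 0 <= C -> C <= C' ->
      C * (expR (u * #|P1 c|%:R) - 1) <= K * (used c)%:R * C'.
    by move=> C0 CC'; rewrite mulrC; apply: ler_pM.
  rewrite mulrCA (mulrC (expR _ - 1)).
  rewrite /raise; case: (c == b).
    by rewrite eqxx; apply: le_mul; rewrite card0 mulr0 expR0 mulr1.
  apply: le_mul; first by case: ifP => _; rewrite ?mul1r ?expR_ge0// mulr_ge0 ?expR_ge0//
    mulr_ge0 ?sqr_ge0.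
  apply: le_trans tauP; case: ifP => _.
    by rewrite card0 mulr0 expR0 mulr1.
  apply: ler_wpM2l; first exact: (mulr_ge0 (ler0n _ 2) (sqr_ge0 _)).
  by rewrite ler_expR; apply: ler_wpM2l; [exact: u0|rewrite ler_nat; exact: P2card].
have total : ((3 / 4)%:E <= (pair_error s i b S)%:E +
    \sum_c 6%:E * sample_mean lam (fun N x => (g c N x)%:E))%E.
  pose f N (x : N.-tuple pos) : \bar R := (\sum_e (bernw (raise th b) e)%:E *
     (data_law zeta (signal s e) x (S N x) + data_law zeta (signal s' e) x (~` S N x)))%E.
  pose f' N (x : N.-tuple pos) : \bar R := (\sum_c 6%:E * (g c N x)%:E)%E.
  have w0 e : 0 <= bernw (raise th b) e by apply: bernw_ge0; exact: raise01.
  have k0 e N (x : N.-tuple pos) : (0 <= data_law zeta (signal s e) x (S N x) +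
      data_law zeta (signal s' e) x (~` S N x))%E.
    by apply: adde_ge0; exact: measure_ge0.
  have f0 N (x : N.-tuple pos) : (0 <= f N x)%E.
    by apply: sume_ge0 => e _; apply: mule_ge0; [rewrite lee_fin|exact: k0].
  have f'0 N (x : N.-tuple pos) : (0 <= f' N x)%E.
    by apply: sume_ge0 => c _; apply: mule_ge0; rewrite lee_fin.
  have s6 : (\sum_c 6%:E * sample_mean lam (fun N x => (g c N x)%:E) = sample_mean lam f')%E.
    apply: esym; apply: (@sample_mean_sum R n d lam I (fun=> 6) (fun c N x => (g c N x)%:E)) => //.
  have sE : (pair_error s i b S)%:E = sample_mean lam f.
    apply: esym; apply: etrans.
      apply: (@sample_mean_sum R n d lam _ (bernw (raise th b)) (fun e N x =>
        data_law zeta (signal s e) x (S N x) + data_law zeta (signal s' e) x (~` S N x))%E).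
        exact: w0.
      exact: k0.
    rewrite /pair_error -sumEFin; apply: eq_bigr => e _.
    by rewrite EFinM event_prob_pairE.
  rewrite s6 sE -sample_meanD//.
  have -> : (3 / 4)%:E = sample_mean lam (fun N (x : N.-tuple pos) => (3 / 4)%:E).
    have h34 : 0 <= 3 / 4 :> R by lra.
    have E := @sample_meanZ R n d lam (3 / 4) (fun N x => 1%E) h34 (fun N x => lee01).
    rewrite (sample_mean1 lam0 n0 d0) mule1 in E.
    by rewrite E.
  apply: le_sample_mean => N x; first by rewrite lee_fin; lra.
  apply: le_trans (test N x) _; apply: leeD; first exact: lexx.
  by rewrite mulr_sumr -sumEFin; apply: lee_sum => c _; rewrite EFinM.
have sum_g : (\sum_c 6%:E * sample_mean lam (fun N x => (g c N x)%:E) <=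
    (6 * (K * (1 + Q%:R * tau)))%:E)%E.
  apply: (@le_trans _ _ (\sum_c (6 * (K * (used c)%:R * (if c == b then 1 else tau)))%:E)%E).
    apply: lee_sum => c _; rewrite EFinM; apply: lee_wpmul2l; first by rewrite lee_fin.
    exact: mean_g.
  rewrite sumEFin lee_fin -mulr_sumr; apply: ler_wpM2l => //.
  under eq_bigr do rewrite -mulrA.
  rewrite -mulr_sumr; apply: ler_wpM2l => //.
  have tau0 : 0 <= tau.
    apply: le_trans tauP; case: ifP => // _.
    by apply: mulr_ge0; [exact: (mulr_ge0 (ler0n _ 2) (sqr_ge0 _))|exact: expR_ge0].
  rewrite (bigD1 b)//= eqxx mulr1; apply: lerD; first by case: (used b).
  apply: (@le_trans _ _ (\sum_(c | used c) tau)).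
    rewrite [leRHS]big_mkcond /= [leRHS](bigD1 b)//=.
    rewrite -[leLHS]add0r; apply: lerD; first by case: ifP.
    apply: ler_sum => c /negbTE ->; by case: (used c); rewrite ?mul1r ?mul0r.
  rewrite sumr_const -[leLHS]mulr_natl; apply: ler_wpM2r; first exact: tau0.
  by rewrite ler_nat.
have := le_trans total (leeD (lexx _) sum_g).
have : K * (1 + Q%:R * tau) <= 24^-1 := small.
by rewrite -EFinD lee_fin; move: (K * _) => z; lra.
Qed.

End Tests.

(** * The staircase *)

Section Staircase.
Context (R : realType) (n d : nat).
Variables (m G q Q : nat) (h : R).
Hypotheses (m0 : (0 < m)%N) (q0 : (0 < q)%N).
Hypotheses (Gn : (2 * m * G <= n)%N) (Qd : (q * Q <= d)%N).
Hypotheses (h0 : 0 <= h) (h1 : h * (G + Q)%:R <= 1).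
Implicit Types (i : 'I_n) (j : 'I_d).

(* The truncations by [G] and [Q] put the rows and columns that do not fill a
   group or a block on a last, never switched, step. *)
Definition group (i : nat) : nat := minn (i %/ (2 * m)) G.
Definition block (j : nat) : nat := minn (j %/ q) Q.
Definition active (i : nat) : bool := (i < 2 * m * G)%N.
Definition upper (i : nat) : bool := active i && (m <= i %% (2 * m))%N.
Definition partner (i : nat) : nat :=
  if active i then (if i %% (2 * m) < m then i + m else i - m)%N else i.

Lemma activeP (i : nat) : active i -> exists g u, [/\ (g < G)%N, (u < 2 * m)%N,
  i = (g * (2 * m) + u)%N, (i %/ (2 * m) = g)%N & (i %% (2 * m) = u)%N].
Proof.
move=> ai; exists (i %/ (2 * m))%N, (i %% (2 * m))%N; split => //.
- by rewrite ltn_divLR ?muln_gt0// mulnC.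
- by rewrite ltn_mod muln_gt0.
- exact: divn_eq.
Qed.

Lemma divmod_unique g u : (u < 2 * m)%N ->
  ((g * (2 * m) + u) %/ (2 * m) = g)%N * ((g * (2 * m) + u) %% (2 * m) = u)%N.
Proof.
move=> um; split; first by rewrite divnMDl ?muln_gt0// divn_small// addn0.
by rewrite modnMDl modn_small.
Qed.

Lemma active_of g u : (g < G)%N -> (u < 2 * m)%N -> active (g * (2 * m) + u).
Proof.
move=> gG um; rewrite /active; apply: (@leq_trans (g.+1 * (2 * m))).
  by rewrite mulSn addnC ltn_add2r.
by rewrite [X in (_ <= X)%N]mulnC leq_mul2r gG orbT.
Qed.

Lemma partnerP (i : nat) : active i -> exists g u u', [/\ (g < G)%N, (u < 2 * m)%N, (u' < 2 * m)%N &
  [/\ i = (g * (2 * m) + u)%N, partner i = (g * (2 * m) + u')%N,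
      (m <= u')%N = ~~ (m <= u)%N & u' = if (u < m)%N then (u + m)%N else (u - m)%N]].
Proof.
move=> ai; have [g [u [gG um iE id im]]] := activeP ai.
exists g, u, (if (u < m)%N then (u + m)%N else (u - m)%N).
rewrite /partner ai im; split => //; first by case: ifP; lia.
split => //; rewrite ?iE; first by case: ifP; lia.
by case: ifP; lia.
Qed.

Lemma group_of g u : (g < G)%N -> (u < 2 * m)%N -> group (g * (2 * m) + u) = g.
Proof. by move=> gG um; rewrite /group (divmod_unique g um); lia. Qed.

Lemma upper_of g u : (g < G)%N -> (u < 2 * m)%N -> upper (g * (2 * m) + u) = (m <= u)%N.
Proof. by move=> gG um; rewrite /upper active_of//= (divmod_unique g um). Qed.

Lemma active_partner (i : nat) : active (partner i) = active i.
Proof.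
have [ai|nai] := boolP (active i); last by rewrite /partner (negbTE nai) (negbTE nai).
by have [g [u [u' [gG um um' [_ -> _ _]]]]] := partnerP ai; exact: active_of.
Qed.

Lemma group_partner (i : nat) : group (partner i) = group i.
Proof.
have [ai|nai] := boolP (active i); last by rewrite /partner (negbTE nai).
by have [g [u [u' [gG um um' [-> -> _ _]]]]] := partnerP ai; rewrite !group_of.
Qed.

Lemma upper_partner (i : nat) : active i -> upper (partner i) = ~~ upper i.
Proof.
move=> ai; have [g [u [u' [gG um um' [-> -> E _]]]]] := partnerP ai.
by rewrite !upper_of.
Qed.

Lemma partnerK (i : nat) : partner (partner i) = i.
Proof.
have [ai|nai] := boolP (active i); last by rewrite /partner !(negbTE nai).
have [g [u [u' [gG um um' [iE pE E u'E]]]]] := partnerP ai.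
rewrite pE /partner active_of// (divmod_unique g um').
by move: iE u'E; do ?case: ifP; lia.
Qed.

Lemma partner_lt (i : nat) : (i < n)%N -> (partner i < n)%N.
Proof.
move=> lin; have [ai|nai] := boolP (active i); last by rewrite /partner (negbTE nai).
by apply: leq_trans Gn; move: ai; rewrite -active_partner.
Qed.

Definition sigma i : 'I_n := Ordinal (partner_lt (ltn_ord i)).

Lemma sigmaK : involutive sigma.
Proof. by move=> i; apply: val_inj; rewrite /= partnerK. Qed.

Definition step_base i j : R := h * (group i + block j)%:R.

Definition step_cell i j : option ('I_G.+1 * 'I_Q.+1) :=
  if active i && (j < q * Q)%N then Some (inord (group i), inord (block j)) else None.

Definition above i (k : 'I_n) : bool := (group i * (2 * m) + m <= k)%N.

Let good : pred 'I_n := fun i => upper i.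
Let act : pred 'I_n := fun i => active i.

Lemma group_leG i : (group i <= G)%N. Proof. exact: geq_minr. Qed.
Lemma block_leQ j : (block j <= Q)%N. Proof. exact: geq_minr. Qed.

Lemma block_lt (j : nat) : (j < q * Q)%N -> block j = (j %/ q)%N /\ (j %/ q < Q)%N.
Proof.
move=> jq; have jQ : (j %/ q < Q)%N by rewrite ltn_divLR// mulnC.
by rewrite /block; split => //; lia.
Qed.

Local Notation lit := (lit step_cell).
Local Notation pattern := (pattern step_base step_cell good h).

Lemma eq_cell i i' j j' : active i -> active i' -> (j < q * Q)%N -> (j' < q * Q)%N ->
  group i = group i' -> block j = block j' -> step_cell i j = step_cell i' j'.
Proof. by rewrite /step_cell => -> -> -> -> -> ->. Qed.

Lemma pattern_ge e i j : h * (group i + block j)%:R <= pattern e i j.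
Proof. by rewrite mxE /step_base lerDl; case: ifP. Qed.

Lemma pattern_hi e i j : upper i -> lit i j e ->
  pattern e i j = h * ((group i + block j).+1)%:R.
Proof. by move=> ui l; rewrite mxE /good ui l /= -natr1 mulrDr mulr1. Qed.

Lemma pattern_lo e i j : ~~ (upper i && lit i j e) -> pattern e i j = h * (group i + block j)%:R.
Proof. by move=> /negbTE ul; rewrite mxE /good ul addr0. Qed.

Lemma litP e i j : lit i j e -> active i /\ (j < q * Q)%N.
Proof. by rewrite /lit /step_cell; case: ifP => // /andP[]. Qed.

Lemma group_mono (i i' : nat) : (i <= i')%N -> (group i <= group i')%N.
Proof. by move=> ii'; have := leq_div2r (2 * m) ii'; rewrite /group; lia. Qed.

Lemma block_mono (i i' : nat) : (i <= i')%N -> (block i <= block i')%N.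
Proof. by move=> ii'; have := leq_div2r q ii'; rewrite /block; lia. Qed.

Lemma step_row e i i' j : i' = i.+1 :> nat -> pattern e i j <= pattern e i' j.
Proof.
move=> ii'; have gg : (group i <= group i')%N by apply: group_mono; rewrite ii'.
have [/andP[ui l]|ul] := boolP (upper i && lit i j e); last first.
  rewrite (pattern_lo ul); apply: le_trans (pattern_ge e i' j).
  by rewrite ler_wpM2l// ler_nat leq_add2r.
rewrite (pattern_hi ui l); have [ai jq] := litP l.
have [g [u [gG um iE id im]]] := activeP ai.
have ug : (m <= u)%N by move: ui; rewrite iE upper_of.
have [u1|u1] := ltnP u.+1 (2 * m); last first.
  apply: le_trans (pattern_ge e i' j); rewrite ler_wpM2l// ler_nat.
  rewrite -addSn leq_add2r iE group_of//.
  have -> : (i' = (g.+1 * (2 * m) + 0)%N :> nat) by lia.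
  by rewrite /group divnMDl ?muln_gt0// div0n addn0; lia.
have i'E : (i' = (g * (2 * m) + u.+1)%N :> nat) by lia.
rewrite pattern_hi.
- by rewrite i'E iE !group_of.
- by rewrite i'E upper_of//; lia.
- have -> // : lit i' j e = lit i j e.
  rewrite /lit (@eq_cell i' i j j)//; first by rewrite i'E active_of.
  by rewrite i'E iE !group_of.
Qed.

Lemma step_col e i j j' : j' = j.+1 :> nat -> pattern e i j <= pattern e i j'.
Proof.
move=> jj'; have bb : (block j <= block j')%N by apply: block_mono; rewrite jj'.
have [/andP[ui l]|ul] := boolP (upper i && lit i j e); last first.
  rewrite (pattern_lo ul); apply: le_trans (pattern_ge e i j').
  by rewrite ler_wpM2l// ler_nat leq_add2l.
rewrite (pattern_hi ui l); have [ai jq] := litP l.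
have [bj bQ] := block_lt jq.
have [E|ne] := eqVneq (block j) (block j'); last first.
  apply: le_trans (pattern_ge e i j'); rewrite ler_wpM2l// ler_nat.
  by rewrite -addnS leq_add2l ltn_neqAle ne bb.
have j'q : (j' < q * Q)%N.
  rewrite mulnC -ltn_divLR//; move: E bQ bj; rewrite /block; lia.
rewrite pattern_hi ?E//.
have -> // : lit i j' e = lit i j e.
by rewrite /lit (@eq_cell i i j' j).
Qed.

Lemma pattern_bounds e i j : 0 <= pattern e i j <= 1.
Proof.
apply/andP; split; first by apply: le_trans (pattern_ge e i j); rewrite mulr_ge0.
have [/andP[ui l]|ul] := boolP (upper i && lit i j e); last first.
  rewrite (pattern_lo ul); apply: le_trans h1; rewrite ler_wpM2l// ler_nat.
  by apply: leq_add; [exact: group_leG|exact: block_leQ].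
rewrite (pattern_hi ui l); apply: le_trans h1; rewrite ler_wpM2l// ler_nat.
have [ai jq] := litP l; have [g [u [gG um iE _ _]]] := activeP ai.
by rewrite iE group_of//; have [-> bQ] := block_lt jq; lia.
Qed.

Lemma staircase_biso e : biso (pattern e).
Proof.
split; [exact: pattern_bounds|move=> i i' j; exact: step_row|move=> i j j'; exact: step_col].
Qed.

Lemma staircase_gap e i j k : active i -> lit i j e -> good i = ~~ above i k ->
  h <= `|pattern e i j - pattern e k j|.
Proof.
move=> ai l; have [g [u [gG um iE _ _]]] := activeP ai.
have gi : group i = g by rewrite iE group_of.
have hS (N : nat) : h * N.+1%:R = h * N%:R + h by rewrite -natr1 mulrDr mulr1.
have [_ jq] := litP l.
rewrite /good /above gi; have [ui|ui] := boolP (upper i).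
  move=> /esym; rewrite -ltnNge => kg.
  have : pattern e k j <= h * (g + block j)%:R.
    have [/andP[uk lk]|ul] := boolP (upper k && lit k j e); last first.
      rewrite (pattern_lo ul) ler_wpM2l// ler_nat leq_add2r.
      rewrite -(@group_of g (2 * m).-1)//; last by lia.
      by apply: group_mono; lia.
    have [ak _] := litP lk; have [g' [u' [gG' um' kE _ _]]] := activeP ak.
    have mu' : (m <= u')%N by move: uk; rewrite kE upper_of.
    rewrite (pattern_hi uk lk) kE group_of// ler_wpM2l// ler_nat -addSn leq_add2r.
    rewrite ltnNge; apply/negP => gg'; have := leq_mul gg' (leqnn (2 * m)); lia.
  by rewrite (pattern_hi ui l) gi hS => le; apply: le_trans (ler_norm _); lra.
move=> /esym/negbFE kg.
have u_lt : (u < m)%N by move: ui; rewrite iE upper_of// -ltnNge.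
have ge : h * ((g + block j).+1)%:R <= pattern e k j.
  have gk : (g <= group k)%N by rewrite -gi; apply: group_mono; lia.
  have [E|ne] := eqVneq g (group k); last first.
    apply: le_trans (pattern_ge e k j); rewrite ler_wpM2l// ler_nat -addSn leq_add2r.
    by rewrite ltn_neqAle ne gk.
  have kd : (k %/ (2 * m) = g)%N by move: E gG; rewrite /group; lia.
  have kE := divn_eq k (2 * m); rewrite kd in kE.
  have u'm : (k %% (2 * m) < 2 * m)%N by rewrite ltn_mod muln_gt0.
  have ak : active k by rewrite kE active_of.
  rewrite pattern_hi -?E//.
    by rewrite kE upper_of//; lia.
  have -> // : lit k j e = lit i j e.
  by rewrite /lit (@eq_cell k i j j)// gi.
have -> : pattern e i j = h * (g + block j)%:R.
  by rewrite pattern_lo ?gi// (negbTE ui).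
rewrite distrC; apply: le_trans (ler_norm _).
by move: ge; rewrite hS; lra.
Qed.

Lemma card_le_ord (T : finType) (P : pred T) (k : nat) (f : T -> nat) :
  (forall x, P x -> f x < k)%N ->
  (forall x y, P x -> P y -> f x = f y -> x = y) -> (#|P| <= k)%N.
Proof.
move=> fk finj; case: k fk => [|k] fk.
  by rewrite leqn0; apply/eqP/eq_card0 => x; apply/negbTE/negP => /fk.
rewrite -[leqRHS]card_ord; apply: (@leq_card_in _ _ (fun x => inord (f x) : 'I_k.+1)).
by move=> x y Px Py /(congr1 val); rewrite /= !inordK ?fk//; exact: finj.
Qed.

Lemma step_cellP i j c : step_cell i j = Some c ->
  [/\ active i, (j < q * Q)%N, group i = c.1 :> nat & block j = c.2 :> nat].
Proof.
rewrite /step_cell; case: ifP => // /andP[ai jq] [<-] /=; split => //.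
  by rewrite inordK// ltnS group_leG.
by rewrite inordK// ltnS block_leQ.
Qed.

Lemma card_cell_row i c : (#|[pred j | step_cell i j == Some c]| <= q)%N.
Proof.
apply: (@card_le_ord _ _ _ (fun j : 'I_d => j %% q)%N) => [j _|j j']; first by rewrite ltn_mod.
move=> /= /eqP/step_cellP[_ jq _ jc] /eqP/step_cellP[_ jq' _ jc'] E.
have [bj _] := block_lt jq; have [bj' _] := block_lt jq'.
apply: val_inj => /=; rewrite (divn_eq j q) (divn_eq j' q) E.
by rewrite -bj -bj' jc jc'.
Qed.

Lemma card_cell_used i : (#|[pred c | [exists j, step_cell i j == Some c]]| <= Q)%N.
Proof.
apply: (@card_le_ord _ _ _ (fun c : 'I_G.+1 * 'I_Q.+1 => c.2 : nat)) => [c|c c'] /=.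
  move=> /existsP[j /eqP/step_cellP[_ jq _ <-]]; by have [-> ] := block_lt jq.
move=> /existsP[j /eqP/step_cellP[_ _ c1 _]] /existsP[j' /eqP/step_cellP[_ _ c1' _]].
case: c c' c1 c1' => [a b] [a' b'] /= E E' bb'; congr pair; apply: val_inj => //=.
by rewrite -E -E'.
Qed.

Lemma card_cell_good c :
  (#|[pred p : 'I_n * 'I_d | good p.1 && (step_cell p.1 p.2 == Some c)]| <= m * q)%N.
Proof.
apply: (@card_le_ord _ _ _ (fun p : 'I_n * 'I_d => (p.1 %% (2 * m) - m) * q + p.2 %% q)%N).
  move=> [i j] /= /andP[/andP[_ mu] _].
  have um : (i %% (2 * m) < 2 * m)%N by rewrite ltn_mod muln_gt0.
  apply: (@leq_trans ((i %% (2 * m) - m).+1 * q)).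
    by rewrite mulSn addnC ltn_add2r ltn_mod.
  by rewrite leq_mul2r; apply/orP; right; lia.
move=> [i j] [i' j'] /= /andP[/andP[ai mu] /eqP/step_cellP[_ jq gi jc]].
move=> /andP[/andP[ai' mu'] /eqP/step_cellP[_ jq' gi' jc']] E.
have E1 : (i %% (2 * m) - m = i' %% (2 * m) - m)%N.
  have := congr1 (fun z => z %/ q)%N E; rewrite !divnMDl//.
  by rewrite !(divn_small (ltn_pmod _ q0)) !addn0.
have E2 : (j %% q = j' %% q)%N by move: E; rewrite E1 => /addnI.
have [bj _] := block_lt jq; have [bj' _] := block_lt jq'.
congr pair; apply: val_inj => /=; last first.
  by rewrite (divn_eq j q) (divn_eq j' q) E2 -bj -bj' jc jc'.
have [g [u [gG um iE id im]]] := activeP ai.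
have [g' [u' [gG' um' iE' id' im']]] := activeP ai'.
have gg' : g = g' by rewrite -(@group_of g u)// -(@group_of g' u')// -iE -iE' gi gi'.
suff uu' : u = u' by rewrite iE iE' gg' uu'.
by rewrite im in E1 mu; rewrite im' in E1 mu'; clear -E1 mu mu'; lia.
Qed.

Lemma card_cell_some i : (#|[pred j | step_cell i j != None]| <= q * Q)%N.
Proof.
apply: (@card_le_ord _ _ _ (fun j => j : nat)) => [j|j j' _ _]; last exact: val_inj.
by rewrite /= /step_cell; case: ifP => // /andP[].
Qed.

Lemma sum_active_cells :
  \sum_(i < n) \sum_(j < d) (active i && (step_cell i j != None))%:R = (2 * m * G * (q * Q))%:R :> R.
Proof.
have cnt (N M : nat) : (N <= M)%N -> \sum_(k < M) ((k < N)%N%:R : R) = N%:R.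
  move=> NM; transitivity (\sum_(k < N) (1 : R)); last by rewrite sumr_const card_ord.
  rewrite (big_ord_widen M (fun=> 1) NM) [RHS]big_mkcond.
  by apply: eq_bigr => k _; case: (k < N)%N.
rewrite natrM -(cnt _ _ Gn) -(cnt _ _ Qd) mulr_suml; apply: eq_bigr => i _.
rewrite mulr_sumr; apply: eq_bigr => j _; rewrite -natrM mulnb /step_cell /active.
by case: (i < _)%N => //; case: (j < _)%N.
Qed.

Lemma step_cell_sigma i j : step_cell (sigma i) j = step_cell i j.
Proof. by rewrite /step_cell /= active_partner group_partner. Qed.

Lemma step_base_sigma i j : step_base (sigma i) j = step_base i j.
Proof. by rewrite /step_base /= group_partner. Qed.

Section Bounds.
Variables (lam zeta : R).
Hypotheses (lam0 : 0 < lam) (n0 : (0 < n)%N) (d0 : (0 < d)%N).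

Lemma staircase_bound (th c : R) : 0 <= th <= 1 -> 0 <= c ->
  (forall s i j b S, act i -> step_cell i j = Some b -> measurable_event S ->
    c <= pair_error lam zeta step_base step_cell good sigma h th s i b S) ->
  ((h ^+ 2 / 2 * th * c * (2 * m * G * (q * Q))%:R)%:E <= minimax_risk n d lam zeta)%E.
Proof.
move=> th01 c0 test; rewrite -sum_active_cells.
apply: (@minimax_ge_pair_error R n d lam zeta lam0 n0 d0 _ step_base step_cell good act sigma
  above h th) => //.
- exact: staircase_biso.
- exact: sigmaK.
- by move=> i; rewrite /act /= active_partner.
- by move=> i; exact: upper_partner.
- exact: step_cell_sigma.
- by move=> i k; rewrite /above /= group_partner.
- by move=> e i j k ai l; exact: staircase_gap.
Qed.

Lemma staircase_erasure :
  ((h ^+ 2 / 2 * expR (- (2 * lam * (q * Q)%:R)) * (2 * m * G * (q * Q))%:R)%:E <=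
    minimax_risk n d lam zeta)%E.
Proof.
have := @staircase_bound 1 (expR (- (2 * lam * (q * Q)%:R))).
rewrite mulr1; apply; rewrite ?ler01 ?lexx ?expR_ge0// => s i j b S ai _ mS.
apply: le_trans (@pair_error_erasure R n d lam zeta lam0 n0 d0 _ step_base step_cell good act
  sigma h 1 _ step_cell_sigma step_base_sigma s i b S ai mS).
  rewrite ler_expR lerN2 ler_wpM2l//; first by rewrite mulr_ge0// ltW.
  by rewrite ler_nat; exact: card_cell_some.
by rewrite ler01 lexx.
Qed.

Lemma staircase_chi2 (th tau : R) : zeta != 0 -> 0 <= th -> (th <= 2^-1 \/ th = 1) ->
  (if th == 1 then 1
   else 2 * th ^+ 2 * expR (lam * (expR (h ^+ 2 / zeta ^+ 2) - 1) * (m * q)%:R)) <= tau ->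
  (expR (lam * (expR (h ^+ 2 / zeta ^+ 2) - 1) * (2 * q)%:R) - 1) * (1 + Q%:R * tau) <= 24^-1 ->
  ((h ^+ 2 / 4 * th * (2 * m * G * (q * Q))%:R)%:E <= minimax_risk n d lam zeta)%E.
Proof.
move=> z0 t0 thP tauP small.
have th01 : 0 <= th <= 1.
  by rewrite t0 /=; case: thP => [|->//]; move=> /le_trans; apply; lra.
have -> : h ^+ 2 / 4 * th = h ^+ 2 / 2 * th * 2^-1 by field.
apply: staircase_bound => // s i j b S ai _ mS.
apply: (@pair_error_chi2 R n d lam zeta lam0 n0 d0 _ step_base step_cell good act
  sigma h th th01 _ step_cell_sigma step_base_sigma z0 s i b S q (m * q) Q tau) => //.
- by move=> i'; exact: upper_partner.
- by move=> c; exact: card_cell_row.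
- exact: card_cell_good.
- exact: card_cell_used.
Qed.

End Bounds.
End Staircase.

(** * Choice of the parameters *)

Section Rounding.
Context (R : realType).
Implicit Types (x y : R).

Lemma round_down x : 1 <= x -> exists2 k : nat, (0 < k)%N & k%:R <= x <= 2 * k%:R.
Proof.
move=> x1; have x0 : 0 <= x by apply: le_trans x1.
have /andP[kx xk] := Num.Theory.truncn_itv x0.
have k0 : (0 < Num.truncn x)%N.
  by rewrite -ltnS -(ltr_nat R); apply: le_lt_trans xk.
exists (Num.truncn x) => //; rewrite kx /=; apply: ltW; apply: lt_le_trans xk _.
by rewrite -natrM ler_nat; lia.
Qed.

Lemma round_up x : 1 <= x -> exists k : nat, x <= k%:R <= 2 * x.
Proof.
move=> x1; have x0 : 0 <= x by apply: le_trans x1.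
have /andP[kx xk] := Num.Theory.truncn_itv x0.
exists (Num.truncn x).+1; rewrite ltW//= -natr1; lra.
Qed.

Lemma expRB1_le x : 0 <= x -> x <= 2^-1 -> expR x - 1 <= 2 * x.
Proof. by move=> x0 x1; have := expR_le1D2 x0 x1; lra. Qed.

(* With [a = ln n], [b = ln d] and [l = ln z], the four exponents are those of
   the terms of the minimum in [RF], and [exp P], [exp Q] are the height of a
   group of rows and the width of a block of columns. *)
Lemma log_balance (a b l : R) : 0 <= a -> 0 <= b ->
  exists P Q : R, [/\ 0 <= P, 0 <= Q, 2 * (l + b) <= 3 * Q + P, 2 * (l + a) <= 3 * P + Q &
   (P + Q <= b -> P <= a) /\
   Num.min (a + b / 6 - l / 3) (Num.min (3 / 4 * a + b / 4 - l / 2)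
     (Num.min (a + b / 2) (2 / 3 * a + b / 2 - l / 3))) <= a + b / 2 - (P + Q) / 2].
Proof.
move=> a0 b0.
have [c1|] := boolP ((l + b <= 0) && (l + a <= 0)).
  case/andP: c1 => c1 c2; exists 0, 0; split=> //; try lra.
  split; first by [].
  by rewrite !ge_min; apply/orP; right; apply/orP; right; apply/orP; left; lra.
rewrite negb_and -!ltNge => c1.
have [c2|c2] := leP (3 * (l + a)) (l + b).
  have ? : 0 < l + b by case/orP: c1 => ?; lra.
  exists 0, (2 / 3 * (l + b)); split; try lra; split; first by [].
  by rewrite !ge_min; apply/orP; left; lra.
have [c3|c3] := leP (3 * (l + b)) (l + a).
  have ? : 0 < l + a by case/orP: c1 => ?; lra.
  exists (2 / 3 * (l + a)), 0; split; try lra; split; first by lra.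
  by rewrite !ge_min; apply/orP; right; apply/orP; right; apply/orP; right; lra.
exists ((3 * (l + a) - (l + b)) / 4), ((3 * (l + b) - (l + a)) / 4); split; try lra.
split; first by lra.
by rewrite !ge_min; apply/orP; right; apply/orP; left; lra.
Qed.

Definition rate_min (n d z : R) : R :=
  Num.min (n * d `^ (1 / 6) / z `^ (1 / 3))
  (Num.min (n `^ (3 / 4) * d `^ (1 / 4) / z `^ (1 / 2))
  (Num.min (n * Num.sqrt d) (n `^ (2 / 3) * Num.sqrt d / z `^ (1 / 3)))).

Lemma balance (n d z : R) : 1 <= n -> 1 <= d -> 0 < z ->
  exists p q : R, [/\ 1 <= p, 1 <= q, (z * d) ^+ 2 <= q ^+ 3 * p, (z * n) ^+ 2 <= p ^+ 3 * q &
   (p * q <= d -> p <= n) /\ rate_min n d z <= n * Num.sqrt d / Num.sqrt (p * q)].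
Proof.
move=> n1 d1 z0.
have n0 : 0 < n by apply: lt_le_trans n1.
have d0 : 0 < d by apply: lt_le_trans d1.
pose a := ln n; pose b := ln d; pose l := ln z.
have nE : n = expR a by rewrite lnK.
have dE : d = expR b by rewrite lnK.
have zE : z = expR l by rewrite lnK.
have a0 : 0 <= a by rewrite ln_ge0.
have b0 : 0 <= b by rewrite ln_ge0.
have [P [Q [P0 Q0 h1 h2 [h3 h4]]]] := log_balance l a0 b0.
have powE (x y : R) : expR x `^ y = expR (y * x).
  by rewrite /powR gt_eqF ?expR_gt0// expRK.
have sqrtE (x : R) : Num.sqrt (expR x) = expR (x / 2).
  rewrite -[RHS]ger0_norm ?expR_ge0// -sqrtr_sqr; congr Num.sqrt.
  by rewrite -expRM_natl; congr expR; field.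
exists (expR P), (expR Q); split.
- by rewrite -[leLHS]expR0 ler_expR.
- by rewrite -[leLHS]expR0 ler_expR.
- by rewrite zE dE -expRD -!expRM_natl -expRD ler_expR; lra.
- by rewrite zE nE -expRD -!expRM_natl -expRD ler_expR; lra.
split; first by rewrite dE nE -expRD !ler_expR.
rewrite /rate_min nE dE zE -expRD !powE !sqrtE -!expRN -!expRD.
have mono (x y : R) : Num.min (expR x) (expR y) = expR (Num.min x y).
  by rewrite !minEle ler_expR; case: ifP.
rewrite !mono ler_expR; apply: le_trans h4; rewrite le_eqVlt; apply/orP; left; apply/eqP.
by congr (Num.min _ (Num.min _ (Num.min _ _))); field.
Qed.

End Rounding.

Lemma divn_half (k l : nat) : (0 < k)%N -> (k <= l)%N -> (l <= 2 * (k * (l %/ k)))%N.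
Proof.
move=> k0 kl; have := ltn_ceil l k0; have : (0 < l %/ k)%N by rewrite divn_gt0.
by set q := (l %/ k)%N; nia.
Qed.

Section Rates.
Context (R : realType) (n d : nat) (lam zeta : R).
Hypotheses (n2 : (2 <= n)%N) (d1 : (1 <= d)%N) (lam0 : 0 < lam).
Local Notation risk := (minimax_risk n d lam zeta).
Local Notation nR := (n%:R : R).
Local Notation dR := (d%:R : R).

Let n0 : (0 < n)%N. Proof. exact: leq_trans n2. Qed.
Let nR2 : 2 <= nR. Proof. by rewrite ler_nat. Qed.
Let dR1 : 1 <= dR. Proof. by rewrite ler1n. Qed.

Lemma risk_ge_le (x y : R) : x <= y -> (y%:E <= risk)%E -> (x%:E <= risk)%E.
Proof. by move=> xy; apply: le_trans; rewrite lee_fin. Qed.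

Let half_gt0 : (0 < n./2)%N. Proof. by lia. Qed.
Let half_le : (2 * n./2 * 1 <= n)%N. Proof. by lia. Qed.
Let half_ge : nR <= 3 * (n./2)%:R.
Proof. by rewrite -[3]/(3%:R) -natrM ler_nat; lia. Qed.

Lemma risk_erasure :
  ((expR (- 2) / 24 * Num.min (nR / lam * expR (- (2 * lam))) (nR * dR))%:E <= risk)%E.
Proof.
have key (D : nat) : (0 < D)%N -> (D <= d)%N ->
    ((nR * D%:R * expR (- (2 * lam * D%:R)) / 12)%:E <= risk)%E.
  move=> D0 Dd; have hh : 2^-1 * (1 + 1)%:R <= 1 :> R by rewrite mulVf ?pnatr_eq0.
  have D1 : (D * 1 <= d)%N by rewrite muln1.
  have h0 : 0 <= 2^-1 :> R by lra.
  have := @staircase_erasure R n d n./2 1 D 1 2^-1 half_gt0 D0 half_le D1 h0 hh lam zeta lam0 n0 d1.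
  rewrite !muln1; apply: risk_ge_le.
  rewrite !natrM; have e0 := expR_ge0 (- (2 * lam * D%:R)).
  set e := expR _ in e0 *.
  have De : 0 <= D%:R * e by rewrite mulr_ge0.
  have -> : nR * D%:R * e / 12 = nR * (D%:R * e) / 12 by rewrite !mulrA.
  have -> : 2^-1 ^+ 2 / 2 * e * (2 * (n./2)%:R * D%:R) = (n./2)%:R * (D%:R * e) / 4.
    by field.
  by move: (D%:R * e) De => w w0; have := ler_wpM2r w0 half_ge; lra.
have e0 := expR_gt0 (- (2 * lam)).
have [l1|l1] := leP 1 lam.
  apply: risk_ge_le (key 1%N isT d1); rewrite !mulr1.
  set mn := Num.min _ _; have : mn <= nR * expR (- (2 * lam)).
    rewrite ge_min; apply/orP; left; rewrite ler_pM2r//.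
    by rewrite ler_pdivrMr//; apply: ler_peMr.
  have : expR (- 2) <= 1 :> R by rewrite -[leRHS]expR0 ler_expR; lra.
  have : 0 <= mn.
    rewrite le_min (mulr_ge0 (ler0n R n) (ler0n R d)) andbT.
    by apply: mulr_ge0; [apply: divr_ge0 => //; exact: ltW|exact: expR_ge0].
  move=> mn0 e2 mnE; have : expR (- 2) * mn <= mn by rewrite ler_piMl.
  lra.
have li : 1 <= lam^-1 by rewrite invf_ge1// ltW.
have [k k0 /andP[k1 k2]] := round_down li.
have lk : lam * k%:R <= 1 by rewrite mulrC -ler_pdivlMr ?div1r.
pose D := minn d k.
have D0 : (0 < D)%N by rewrite /D leq_min d1.
apply: risk_ge_le (key D D0 (geq_minl _ _)).
have DE : (D%:R : R) = Num.min dR k%:R.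
  by rewrite /D /minn minEle ler_nat; case: ltngtP => // ->.
have eD : expR (- 2) <= expR (- (2 * lam * D%:R)) :> R.
  rewrite ler_expR lerN2 -mulrA.
  have : lam * D%:R <= 1.
    by apply: le_trans lk; rewrite ler_pM2l// DE ge_min lexx orbT.
  lra.
set mn := Num.min _ _; have : mn <= 2 * (nR * D%:R).
  rewrite DE; have [dk|kd] := leP dR k%:R.
    rewrite /mn ge_min; apply/orP; right.
    by have := mulr_ge0 (ler0n R n) (ler0n R d); lra.
  rewrite /mn ge_min; apply/orP; left.
  apply: (@le_trans _ _ (nR / lam)).
    apply: ler_piMr; first by rewrite divr_ge0// ltW.
    by rewrite -[leRHS]expR0 ler_expR; have := lam0; lra.
  by rewrite mulrCA ler_pM2l//; have := nR2; lra.
move=> mnD; have nD : 0 <= nR * D%:R by rewrite mulr_ge0.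
have := ler_wpM2l (expR_ge0 (- 2 : R)) mnD; have := ler_wpM2l nD eD.
lra.
Qed.

(* [z = zeta / sqrt lam] *)
Hypothesis zeta0 : 0 < zeta.
Variable z : R.
Hypotheses (z0 : 0 < z) (zl : z ^+ 2 * lam = zeta ^+ 2).

Let z2E : z ^+ 2 = zeta ^+ 2 / lam.
Proof. by rewrite -zl mulfK ?gt_eqF. Qed.

Lemma min_risk_ge (k x y : R) : 0 < k -> x <= k * y ->
  ((expR (- 2) / 24 * Num.min y (nR * dR))%:E <= risk)%E -> 1 <= k ->
  ((expR (- 2) / 24 / k * Num.min x (nR * dR))%:E <= risk)%E.
Proof.
move=> k0 xy H k1; apply: risk_ge_le H; rewrite -mulrA.
apply: ler_wpM2l; first by rewrite divr_ge0// expR_ge0.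
rewrite mulrC ler_pdivrMr// [Num.min y _]minEle; case: ifP => _; rewrite ge_min.
  by rewrite (mulrC y) xy.
by apply/orP; right; rewrite ler_peMr// mulr_ge0.
Qed.

(* For [lam < 1] the factor [exp (-2 lam)] of the erasure bound is harmless. *)
Lemma risk_few_observations (k x : R) : 1 <= k -> lam < 1 -> x <= k * (nR / lam) ->
  ((expR (- 2) / 24 / (k * expR 2) * Num.min x (nR * dR))%:E <= risk)%E.
Proof.
move=> k1 l1 xk; apply: min_risk_ge risk_erasure _.
- by rewrite mulr_gt0 ?expR_gt0//; lra.
- apply: le_trans xk _; rewrite -mulrA ler_wpM2l//; first by lra.
  rewrite mulrCA ler_peMr//; first by rewrite divr_ge0// ltW.
  by rewrite -expRD -[leLHS]expR0 ler_expR; lra.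
- by rewrite -[leLHS]mulr1 ler_pM// -[leLHS]expR0 ler_expR.
Qed.

Let constE (k : R) : expR (- 2) / 24 / (k * expR 2) = expR (- 4) / 24 / k :> R.
Proof.
have -> : - 4 = - 2 + - 2 :> R by ring.
by rewrite (expRD (- 2) (- 2)) (invfM k) -(expRN 2); ring.
Qed.

Lemma chi2_small (A x : R) (q : nat) : 0 <= A -> A <= 2^-1 ->
  4 * q%:R * lam * A <= x -> x <= 2^-1 ->
  expR (lam * (expR A - 1) * (2 * q)%:R) - 1 <= 2 * x.
Proof.
move=> A0 A1 Ax x1; have E := expRB1_le A0 A1.
have e0 : 0 <= expR A - 1 by rewrite subr_ge0 -[leLHS]expR0 ler_expR.
set y := lam * _ * _.
have y0 : 0 <= y by rewrite !mulr_ge0// ltW.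
have yx : y <= x.
  apply: le_trans Ax; rewrite /y natrM.
  have := ler_wpM2l (mulr_ge0 (ltW lam0) (ler0n R q)) E.
  lra.
by apply: le_trans (expRB1_le y0 _) _; lra.
Qed.

Lemma risk_one_block (h : R) (D : nat) : (0 < D)%N -> (D <= d)%N -> 0 <= h -> h <= 2^-1 ->
  h ^+ 2 / zeta ^+ 2 <= 2^-1 -> 20 * 20 * (D%:R * h ^+ 2) <= z ^+ 2 ->
  ((nR * D%:R * h ^+ 2 / 6)%:E <= risk)%E.
Proof.
move=> D0 Dd h0 h1 A1 small; have D1 : (D * 1 <= d)%N by rewrite muln1.
have hh : h * (1 + 1)%:R <= 1 by rewrite -[(1 + 1)%:R]/(2 : R); lra.
have A0 : 0 <= h ^+ 2 / zeta ^+ 2 by rewrite divr_ge0// sqr_ge0.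
have := @staircase_chi2 R n d n./2 1 D 1 h half_gt0 D0 half_le D1 h0 hh lam zeta lam0 n0 d1
  1 1 (lt0r_neq0 zeta0) ler01 (or_intror erefl).
rewrite eqxx => /(_ (lexx _)) H; apply: risk_ge_le (H _); last first.
  have sm : 4 * D%:R * lam * (h ^+ 2 / zeta ^+ 2) <= 96^-1.
    rewrite z2E ler_pdivlMr// in small.
    have -> : 4 * D%:R * lam * (h ^+ 2 / zeta ^+ 2) = 4 * (D%:R * h ^+ 2 * lam) / zeta ^+ 2.
      by field; rewrite lt0r_neq0.
    by rewrite ler_pdivrMr ?exprn_gt0//; have := sqr_ge0 zeta; lra.
  by have := chi2_small A0 A1 sm; lra.
rewrite !natrM; have h2 : 0 <= D%:R * h ^+ 2 by rewrite mulr_ge0// sqr_ge0.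
have -> : nR * D%:R * h ^+ 2 / 6 = nR * (D%:R * h ^+ 2) / 6 by rewrite !mulrA.
have -> : h ^+ 2 / 4 * 1 * (2 * (n./2)%:R * 1 * (D%:R * 1)) =
  (n./2)%:R * (D%:R * h ^+ 2) / 2 by field.
by move: (_ * h ^+ 2) h2 => w w0; have := ler_wpM2r w0 half_ge; lra.
Qed.

Lemma risk_noise : ((expR (- 4) / 60 / 80 * Num.min (z ^+ 2 * nR) (nR * dR))%:E <= risk)%E.
Proof.
have e4 : expR (- 4) <= 1 :> R by rewrite -[leRHS]expR0 ler_expR; lra.
have e0 := expR_gt0 (- 4 : R).
set mn := Num.min _ _.
have mn0 : 0 <= mn.
  by rewrite le_min (mulr_ge0 (sqr_ge0 z) (ler0n R n)) (mulr_ge0 (ler0n R n) (ler0n R d)).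
have weaken : expR (- 4) / 60 / 80 * mn <= mn / 60 / 80.
  by have : expR (- 4) * mn <= mn; [rewrite ler_piMl|lra].
have [small|big] := boolP ((lam < 1) && (zeta < 1)).
  case/andP: small => l1 ze1.
  have le1 : z ^+ 2 * nR <= 1 * (nR / lam).
    rewrite z2E mul1r mulrAC ler_pM2r ?invr_gt0// ler_piMl//.
    by rewrite expr_le1 ?ltW.
  apply: risk_ge_le (risk_few_observations (lexx 1) l1 le1).
  by apply: ler_wpM2r => //; rewrite constE; lra.
have {}big : 1 <= lam \/ 1 <= zeta.
  by move: big; rewrite negb_and -!leNgt => /orP.
have sq1 (x : R) : 1 <= x -> 1 <= x ^+ 2 by move=> x1; rewrite expr_ge1// (le_trans _ x1).
have ze2 : 0 < zeta ^+ 2 by rewrite exprn_gt0.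
have [z1|z1] := leP z 1.
  have z21 : z ^+ 2 <= 1 by rewrite expr_le1//; exact: ltW.
  have l1 : 1 <= lam.
    by case: big => // /sq1; rewrite -zl; have := ler_wpM2r (ltW lam0) z21; lra.
  have A1 : (z / 20) ^+ 2 / zeta ^+ 2 <= 2^-1.
    by rewrite ler_pdivrMr// expr_div_n -zl; have := ler_wpM2l (sqr_ge0 z) l1;
      have := sqr_ge0 z; lra.
  have h0 : 0 <= z / 20 by have := z0; lra.
  have h1 : z / 20 <= 2^-1 by lra.
  have small : 20 * 20 * (1%:R * (z / 20) ^+ 2) <= z ^+ 2.
    by rewrite expr_div_n mul1r; have := sqr_ge0 z; lra.
  have H := @risk_one_block (z / 20) 1 isT d1 h0 h1 A1 small.
  apply: risk_ge_le H.
  apply: le_trans weaken _; rewrite expr_div_n mulr1.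
  have : mn <= z ^+ 2 * nR by rewrite ge_min lexx.
  have := mulr_ge0 (sqr_ge0 z) (ler0n R n); lra.
have z21 : 1 <= z ^+ 2 by apply: sq1; exact: ltW.
have [k k0 /andP[k1 k2]] := round_down z21.
have D0 : (0 < minn d k)%N by rewrite leq_min d1.
have DE : ((minn d k)%:R : R) = Num.min dR k%:R.
  by rewrite /minn minEle ler_nat; case: ltngtP => // ->.
have ze1 : 1 <= zeta ^+ 2.
  by case: big => [l1|/sq1//]; rewrite -zl; have := ler_wpM2l (sqr_ge0 z) l1; lra.
have A1 : 20^-1 ^+ 2 / zeta ^+ 2 <= 2^-1 :> R by rewrite ler_pdivrMr//; lra.
have Dk : (minn d k)%:R <= k%:R :> R by rewrite ler_nat geq_minr.
have h0 : 0 <= 20^-1 :> R by lra.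
have h1 : 20^-1 <= 2^-1 :> R by lra.
have small : 20 * 20 * ((minn d k)%:R * 20^-1 ^+ 2) <= z ^+ 2.
  by move: (minn d k)%:R Dk => D Dk; lra.
have H := @risk_one_block 20^-1 (minn d k) D0 (geq_minl _ _) h0 h1 A1 small.
apply: risk_ge_le H.
apply: le_trans weaken _.
have : mn <= 2 * (nR * (minn d k)%:R).
  rewrite DE; have [dk|kd] := leP dR k%:R.
    rewrite /mn ge_min; apply/orP; right.
    by have := mulr_ge0 (ler0n R n) (ler0n R d); lra.
  rewrite /mn ge_min; apply/orP; left.
  by have := ler_wpM2r (ler0n R n) k2; lra.
lra.
Qed.

Section Balanced.
Variables (m b : nat).
Hypotheses (m0 : (0 < m)%N) (b0 : (0 < b)%N).
Let w : R := m%:R * b%:R.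

Let mR0 : 0 < (m%:R : R). Proof. by rewrite ltr0n. Qed.
Let bR0 : 0 < (b%:R : R). Proof. by rewrite ltr0n. Qed.
Let w0 : 0 < w. Proof. by rewrite mulr_gt0. Qed.

Lemma chi2_row_small (A t : R) : 0 <= A -> A <= 2^-1 -> w * lam * A = (20 * 20)^-1 -> 0 <= t ->
  2 * (t / 4) * expR (lam * (expR A - 1) * (m * b)%:R) <= t.
Proof.
move=> A0 A1 wlA t0; have eA := expRB1_le A0 A1.
have eA0 : 0 <= expR A - 1 by rewrite subr_ge0 -[leLHS]expR0 ler_expR.
rewrite natrM -/w; set y := lam * _ * w.
have y0 : 0 <= y by rewrite !mulr_ge0// ltW.
have y1 : y <= 2^-1.
  have := ler_wpM2l (ltW (mulr_gt0 w0 lam0)) eA; rewrite /y; lra.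
have ey : expR y <= 2 by have := expRB1_le y0 y1; lra.
have := ler_wpM2l t0 ey; lra.
Qed.

Lemma chi2_block_small (A t : R) : 0 <= A -> A <= 2^-1 -> w * lam * A = (20 * 20)^-1 ->
  0 <= t -> t <= m%:R ->
  (expR (lam * (expR A - 1) * (2 * b)%:R) - 1) * (1 + t) <= 24^-1.
Proof.
move=> A0 A1 wlA t0 tm.
have m1 : 1 <= m%:R :> R by rewrite ler1n.
have mV1 : m%:R^-1 <= 1 :> R by rewrite invf_le1.
have mV0 : 0 < m%:R^-1 :> R by rewrite invr_gt0.
have mV : m%:R * m%:R^-1 = 1 :> R by rewrite mulfV// gt_eqF.
have bA : 4 * b%:R * lam * A <= m%:R^-1 / 100.
  rewrite -(ler_pM2l mR0) [leRHS]mulrA mV.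
  have : w * lam * A = m%:R * (b%:R * lam * A) by rewrite /w; ring.
  by rewrite wlA; lra.
have small100 : m%:R^-1 / 100 <= 2^-1 :> R by lra.
have E := chi2_small A0 A1 bA small100.
have s1 : 0 <= 1 + t by lra.
apply: (le_trans (ler_wpM2r s1 E)).
have s2 : 0 <= 2 * (m%:R^-1 / 100) :> R by lra.
have s3 : 1 + t <= 1 + m%:R by lra.
apply: (le_trans (ler_wpM2l s2 s3)); lra.
Qed.

Lemma risk_balanced (p q r : R) : (2 * m <= n)%N -> (b <= d)%N -> 0 < p -> 0 < q ->
  (z * dR) ^+ 2 <= q ^+ 3 * p -> (z * nR) ^+ 2 <= p ^+ 3 * q ->
  p <= 3 * m%:R -> q <= b%:R -> w <= 4 * (p * q) -> 1 <= lam * w -> 4 * w <= dR ->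
  0 < r -> r ^+ 2 = dR / (p * q) ->
  ((z ^+ 2 * (nR * r) / 160 / 160)%:E <= risk)%E.
Proof.
move=> m2n bd p0 q0 hq hp pm b1 wX many w4d r0 r2.
have nR0 : 0 < nR by have := nR2; lra.
have dR0 : 0 < dR by have := dR1; lra.
have X0 : 0 < p * q by rewrite mulr_gt0.
have z20 : 0 < z ^+ 2 by rewrite exprn_gt0.
pose G := (n %/ (2 * m))%N; pose Q := (d %/ b)%N.
have G0 : (0 < G)%N by rewrite divn_gt0 ?muln_gt0.
have Q0 : (0 < Q)%N by rewrite divn_gt0.
have Gn : (2 * m * G <= n)%N by rewrite mulnC leq_trunc_div.
have Qd : (b * Q <= d)%N by rewrite mulnC leq_trunc_div.
have Gn2 : (n <= 2 * (2 * m * G))%N by apply: divn_half; rewrite ?muln_gt0.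
have Qd2 : (d <= 2 * (b * Q))%N by exact: divn_half.
pose h := z / (20 * Num.sqrt w).
have h0 : 0 < h by rewrite divr_gt0// mulr_gt0// sqrtr_gt0.
have h2 : h ^+ 2 = z ^+ 2 / (20 * 20 * w).
  rewrite expr_div_n exprMn sqr_sqrtr; last exact: ltW.
  by [].
have GR : 2 * m%:R * G%:R <= nR by rewrite -!natrM ler_nat.
have QR : b%:R * Q%:R <= dR by rewrite -natrM ler_nat.
have h20 : 0 < 20 * 20 * w by rewrite !mulr_gt0.
have halfE (x : R) : 0 <= x -> z ^+ 2 * x ^+ 2 <= 100 * w -> h * x <= 2^-1.
  move=> x0 H; rewrite -(@ler_pXn2r _ 2) ?nnegrE ?mulr_ge0 ?invr_ge0//; last exact: ltW.
  rewrite exprMn h2 mulrAC ler_pdivrMr//; lra.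
have GR0 : 0 <= 2 * m%:R * G%:R :> R by rewrite !mulr_ge0.
have QR0 : 0 <= b%:R * Q%:R :> R by rewrite mulr_ge0.
have hG : h * G%:R <= 2^-1.
  apply: halfE => //; have c0 : 0 < (2 * m%:R) ^+ 2 :> R by rewrite exprn_gt0// mulr_gt0.
  rewrite -(ler_pM2l c0).
  have s1 : (2 * m%:R * G%:R) ^+ 2 <= nR ^+ 2 by rewrite lerXn2r// nnegrE.
  have s2 := ler_wpM2l (ltW z20) s1.
  have s3 : p ^+ 3 * q <= (3 * m%:R) ^+ 3 * b%:R.
    apply: ler_pM => //; [by rewrite exprn_ge0// ltW|exact: ltW|].
    by rewrite lerXn2r// nnegrE ?mulr_ge0// ltW.
  have s4 : z ^+ 2 * nR ^+ 2 <= p ^+ 3 * q by rewrite -exprMn.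
  have s5 : 0 <= m%:R ^+ 2 * w by rewrite mulr_ge0 ?sqr_ge0// ltW.
  have -> : (2 * m%:R) ^+ 2 * (z ^+ 2 * G%:R ^+ 2) = z ^+ 2 * (2 * m%:R * G%:R) ^+ 2 by ring.
  apply: (le_trans s2); apply: (le_trans s4); apply: (le_trans s3).
  have -> : (3 * m%:R) ^+ 3 * b%:R = 27 * (m%:R ^+ 2 * w) by rewrite /w; ring.
  have -> : (2 * m%:R) ^+ 2 * (100 * w) = 4 * (100 * (m%:R ^+ 2 * w)) by ring.
  lra.
have hQ : h * Q%:R <= 2^-1.
  apply: halfE => //; have c0 : 0 < b%:R ^+ 2 :> R by rewrite exprn_gt0.
  rewrite -(ler_pM2l c0).
  have s1 : (b%:R * Q%:R) ^+ 2 <= dR ^+ 2 by rewrite lerXn2r// nnegrE.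
  have s2 := ler_wpM2l (ltW z20) s1.
  have s3 : q ^+ 3 * p <= b%:R ^+ 3 * (3 * m%:R).
    apply: ler_pM => //; [by rewrite exprn_ge0// ltW|exact: ltW|].
    by rewrite lerXn2r// nnegrE// ltW.
  have s4 : z ^+ 2 * dR ^+ 2 <= q ^+ 3 * p by rewrite -exprMn.
  have s5 : 0 <= b%:R ^+ 2 * w by rewrite mulr_ge0 ?sqr_ge0// ltW.
  have -> : b%:R ^+ 2 * (z ^+ 2 * Q%:R ^+ 2) = z ^+ 2 * (b%:R * Q%:R) ^+ 2 by ring.
  apply: (le_trans s2); apply: (le_trans s4); apply: (le_trans s3).
  have -> : b%:R ^+ 3 * (3 * m%:R) = 3 * (b%:R ^+ 2 * w) by rewrite /w; ring.
  lra.
have hGQ : h * (G + Q)%:R <= 1 by rewrite natrD mulrDr; lra.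
pose th := Num.sqrt (w / dR) / 2.
have th2 : th ^+ 2 = w / dR / 4.
  rewrite expr_div_n sqr_sqrtr ?divr_ge0 ?ltW//.
  by have -> : 2 ^+ 2 = 4 :> R by ring.
have th0 : 0 <= th by rewrite divr_ge0 ?sqrtr_ge0.
have wd : w / dR <= 4^-1 by rewrite ler_pdivrMr//; lra.
have th4 : th <= 4^-1.
  rewrite -(@ler_pXn2r _ 2) ?nnegrE// th2; lra.
have thn1 : (th == 1) = false by apply/negbTE/eqP => E; move: th4; rewrite E; lra.
pose A := h ^+ 2 / zeta ^+ 2.
have AE : A = (20 * 20 * (w * lam))^-1.
  rewrite /A h2 -zl; field.
  by rewrite !gt_eqF.
have wl0 : 0 < w * lam by rewrite mulr_gt0.
have A0 : 0 <= A by rewrite AE invr_ge0 mulr_ge0// ltW.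
have wlA : w * lam * A = (20 * 20)^-1 by rewrite AE; field; rewrite !gt_eqF.
have A1 : A <= 2^-1.
  have := ler_wpM2r A0 many; rewrite (mulrC lam) wlA mul1r; lra.
have th2' : th <= 2^-1 by lra.
have wd0 : 0 <= w / dR by rewrite divr_ge0// ltW.
have cond1 : (if th == 1 then 1 else
    2 * th ^+ 2 * expR (lam * (expR A - 1) * (m * b)%:R)) <= w / dR.
  by rewrite thn1 th2 chi2_row_small.
have Qw : Q%:R * (w / dR) <= m%:R.
  by rewrite mulrA ler_pdivrMr// /w mulrCA ler_pM2l// mulrC.
have Qw0 : 0 <= Q%:R * (w / dR) by rewrite mulr_ge0.
have cond2 := chi2_block_small A0 A1 wlA Qw0 Qw.
have H := @staircase_chi2 R n d m G b Q h m0 b0 Gn Qd (ltW h0) hGQ lam zeta lam0 n0 d1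
  th (w / dR) (lt0r_neq0 zeta0) th0 (or_introl th2') cond1 cond2.
apply: risk_ge_le H.
have thr : r / 4 <= th * dR / w.
  rewrite -(@ler_pXn2r _ 2) ?nnegrE//; last 2 first.
  - by rewrite divr_ge0// ltW.
  - by rewrite divr_ge0 ?mulr_ge0// ltW.
  have -> : (r / 4) ^+ 2 = dR / (p * q) / 4 / 4 by rewrite expr_div_n r2; field; rewrite !gt_eqF.
  have -> : (th * dR / w) ^+ 2 = dR / w / 4.
    by rewrite expr_div_n exprMn th2; field; rewrite !gt_eqF.
  have s1 : (p * q)^-1 <= 4 * w^-1.
    by rewrite -ler_pdivrMl// mulrC -invfM lef_pV2 ?posrE ?mulr_gt0//; rewrite mulrC.
  have := ler_wpM2l (ltW dR0) s1; lra.
have D2 : dR <= 2 * (b * Q)%:R by rewrite -natrM ler_nat.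
have N2 : nR <= 2 * (2 * m * G)%:R by rewrite -natrM ler_nat.
rewrite natrM; set N := (2 * m * G)%:R in N2 *; set D := (b * Q)%:R in D2 *.
have ND : nR * dR <= 4 * (N * D).
  by have := ler_pM (ltW nR0) (ltW dR0) N2 D2; lra.
have s1 := ler_wpM2l (mulr_ge0 (ltW z20) (ltW nR0)) thr.
have c0 : 0 <= z ^+ 2 * th / w by rewrite divr_ge0 ?mulr_ge0// ltW.
have s2 := ler_wpM2l c0 ND.
have hE : h ^+ 2 / 4 * th * (N * D) = z ^+ 2 * th / w * (N * D) / 160 / 10.
  by rewrite h2; field; rewrite !gt_eqF.
rewrite hE.
have {}s1 : z ^+ 2 * (nR * r) / 4 <= z ^+ 2 * th / w * (nR * dR).
  by move: s1; rewrite !mulrA; lra.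
lra.
Qed.

End Balanced.

Lemma risk_main :
  ((expR (- 4) / 160 / 160 * Num.min (z ^+ 2 * rate_min nR dR z) (nR * dR))%:E <= risk)%E.
Proof.
have e4 : expR (- 4) <= 1 :> R by rewrite -[leRHS]expR0 ler_expR; lra.
have e0 := expR_gt0 (- 4 : R).
have n1 : 1 <= nR by have := nR2; lra.
have nR0 : 0 < nR by lra.
have dR0 : 0 < dR by have := dR1; lra.
have [p [q [p1 q1 hq hp [pn rate]]]] := balance n1 dR1 z0.
have p0 : 0 < p by lra.
have q0 : 0 < q by lra.
have X0 : 0 < p * q by rewrite mulr_gt0.
have z20 : 0 < z ^+ 2 by rewrite exprn_gt0.
pose r := Num.sqrt dR / Num.sqrt (p * q).
have r0 : 0 < r by rewrite divr_gt0// sqrtr_gt0.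
have r2 : r ^+ 2 = dR / (p * q) by rewrite expr_div_n !sqr_sqrtr// ltW.
set mn := Num.min _ _.
have mnT : mn <= z ^+ 2 * (nR * r).
  rewrite ge_min; apply/orP; left; rewrite ler_pM2l//.
  by apply: le_trans rate _; rewrite mulrA.
have mnnd : mn <= nR * dR by rewrite ge_min lexx orbT.
have [big|small] := leP dR (16 * (p * q)).
  have r4 : r <= 4.
    rewrite -(@ler_pXn2r _ 2) ?nnegrE//; last exact: ltW.
    by rewrite r2 ler_pdivrMr//; lra.
  apply: risk_ge_le risk_noise.
  suff : mn <= 4 * Num.min (z ^+ 2 * nR) (nR * dR).
    have m0 : 0 <= Num.min (z ^+ 2 * nR) (nR * dR).
      by rewrite le_min (mulr_ge0 (sqr_ge0 z) (ler0n R n)) (mulr_ge0 (ler0n R n) (ler0n R d)).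
    by move=> /(ler_wpM2l (ltW e0)); have := mulr_ge0 (ltW e0) m0; lra.
  rewrite [X in 4 * X]minEle; case: ifP => _.
    apply: le_trans mnT _; have := ler_wpM2l (mulr_ge0 (ltW z20) (ltW nR0)) r4; lra.
  by apply: le_trans mnnd _; rewrite ler_peMl ?mulr_ge0//; lra.
have {}pn : p <= nR by apply: pn; lra.
have [k /andP[k1 k2]] := round_up p1.
have [b /andP[b1 b2]] := round_up q1.
have k0 : (0 < k)%N by rewrite -(ltr_nat R); lra.
have b0 : (0 < b)%N by rewrite -(ltr_nat R); lra.
have hg := half_ge.
pose m := minn k n./2.
have m0 : (0 < m)%N by rewrite leq_min k0 half_gt0.
have mk : (m%:R : R) <= 2 * p by apply: le_trans k2; rewrite ler_nat geq_minl.
have pm : p <= 3 * m%:R.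
  by rewrite /m /minn; case: ifP => _; lra.
have m2n : (2 * m <= n)%N.
  by apply: leq_trans half_le; rewrite muln1 leq_mul// geq_minr.
pose w : R := m%:R * b%:R.
have mR0 : 0 < (m%:R : R) by rewrite ltr0n.
have bR0 : 0 < (b%:R : R) by rewrite ltr0n.
have w0 : 0 < w by rewrite mulr_gt0.
have w1 : 1 <= w by rewrite /w -natrM ler1n muln_gt0 m0.
have wX : w <= 4 * (p * q).
  by have := ler_pM (ltW mR0) (ltW bR0) mk b2; rewrite -/w; lra.
have Xw : p * q <= 3 * w.
  by have := ler_pM (ltW p0) (ltW q0) pm b1; rewrite /w; lra.
have [few|many] := ltP (lam * w) 1.
  have l1 : lam < 1 by have := ler_wpM2l (ltW lam0) w1; lra.
  have T3 : z ^+ 2 * (nR * r) <= 3 * (nR / lam).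
    have qd : q <= dR by have := ler_wpM2r (ltW q0) p1; lra.
    have rq : r <= dR / q.
      have dq1 : 1 <= dR / q by rewrite ler_pdivlMr ?mul1r.
      rewrite -(@ler_pXn2r _ 2) ?nnegrE//; [|exact: ltW|by lra].
      apply: (@le_trans _ _ (dR / q)); last by rewrite expr2 ler_peMl//; lra.
      rewrite r2 ler_pM2l// lef_pV2 ?posrE//.
      by have := ler_wpM2r (ltW q0) p1; lra.
    have lX : lam * (p * q) <= 3.
      by have := ler_wpM2l (ltW lam0) Xw; lra.
    have q2r : q ^+ 2 * r <= dR ^+ 2.
      apply: (@le_trans _ _ (q ^+ 2 * (dR / q))); first by rewrite ler_pM2l ?exprn_gt0.
      have -> : q ^+ 2 * (dR / q) = q * dR by field; rewrite gt_eqF.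
      by rewrite expr2 ler_pM2r.
    have main : z ^+ 2 * r * lam <= 3.
      have d20 : 0 < dR ^+ 2 by rewrite exprn_gt0.
      rewrite -(ler_pM2r d20).
      have s1 : z ^+ 2 * dR ^+ 2 <= q ^+ 2 * (p * q).
        by move: hq; rewrite exprMn exprSr; lra.
      have := ler_wpM2r (ltW (mulr_gt0 r0 lam0)) s1.
      have := ler_wpM2l (ltW (mulr_gt0 r0 (exprn_gt0 2 q0))) lX.
      lra.
    rewrite (mulrCA (z ^+ 2)) (mulrCA 3) ler_pM2l//.
    by rewrite ler_pdivlMr.
  have := risk_few_observations (_ : 1 <= 3 :> R) l1 T3; rewrite ler1n => /(_ isT).
  apply: risk_ge_le; set mn' := Num.min _ _.
  have mn'_ge : mn <= mn' by rewrite le_min mnT mnnd.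
  have mn0 : 0 <= mn'.
    rewrite le_min (mulr_ge0 (ler0n R n) (ler0n R d)) andbT.
    by apply: mulr_ge0; [exact: sqr_ge0|apply: mulr_ge0 => //; exact: ltW].
  rewrite constE.
  have := ler_wpM2l (ltW e0) mn'_ge; have := mulr_ge0 (ltW e0) mn0; lra.
have bd : (b <= d)%N.
  rewrite -(ler_nat R); have := ler_wpM2r (ltW q0) p1; lra.
have w4d : 4 * w <= dR by lra.
have := risk_balanced m0 b0 m2n bd p0 q0 hq hp pm b1 wX many w4d r0 r2.
apply: risk_ge_le.
have -> : expR (- 4) / 160 / 160 * mn = expR (- 4) * mn / 160 / 160 by ring.
have s0 : 0 <= z ^+ 2 * (nR * r) by rewrite !mulr_ge0// ltW.
have s3 : expR (- 4) * mn <= z ^+ 2 * (nR * r).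
  apply: (le_trans (ler_wpM2l (ltW e0) mnT)); exact: ler_piMl.
lra.
Qed.

End Rates.

Theorem theorem4p1 (R : realType) :
  exists2 c : R, 0 < c &
    forall (n d : nat) (lam zeta : R),
      (2 <= n)%N -> (1 <= d)%N -> 0 < lam -> 0 <= zeta ->
      ((c * Num.min (RF n d (zeta / Num.sqrt lam)
                     + n%:R / lam * expR (- (2 * lam)))
                    (n * d)%:R)%:E
       <= minimax_risk n d lam zeta)%E.
Proof.
have e0 := expR_gt0 (- 4 : R).
exists (expR (- 4) / 160 / 160 / 3); first by lra.
move=> n d lam zeta n2 d1 lam0 zeta0; rewrite natrM.
set E := n%:R / lam * _; set nd := n%:R * d%:R.
have nd0 : 0 <= nd by rewrite mulr_ge0.
have E0 : 0 <= E by rewrite mulr_ge0 ?expR_ge0// divr_ge0// ltW.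
have mE0 : 0 <= Num.min E nd by rewrite le_min E0.
have HE : ((expR (- 4) / 160 / 160 * Num.min E nd)%:E <= minimax_risk n d lam zeta)%E.
  apply: risk_ge_le (@risk_erasure R n d lam zeta n2 d1 lam0).
  have e42 : expR (- 4) <= expR (- 2) :> R by rewrite ler_expR; lra.
  have := ler_wpM2r mE0 e42; have := mulr_ge0 (ltW e0) mE0; rewrite -/nd -/E; lra.
have [ze|zeta1] := eqVneq zeta 0.
  rewrite [RF _ _ _](_ : _ = 0) ?add0r; last by rewrite /RF ze mul0r eqxx.
  apply: risk_ge_le HE.
  by have := mulr_ge0 (ltW e0) mE0; lra.
have {zeta1}zeta0 : 0 < zeta by rewrite lt_neqAle eq_sym zeta1.
set z := zeta / Num.sqrt lam.
have z0 : 0 < z by rewrite divr_gt0// sqrtr_gt0.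
have zl : z ^+ 2 * lam = zeta ^+ 2.
  by rewrite expr_div_n sqr_sqrtr ?ltW// divfK// gt_eqF.
have -> : RF n d z = z ^+ 2 * rate_min n%:R d%:R z + z ^+ 2 * n%:R.
  by rewrite /RF gt_eqF// mulrDr.
have HT := risk_main n2 d1 lam0 zeta0 z0 zl.
have HN : ((expR (- 4) / 160 / 160 * Num.min (z ^+ 2 * n%:R) nd)%:E
    <= minimax_risk n d lam zeta)%E.
  apply: risk_ge_le (risk_noise n2 d1 lam0 zeta0 z0 zl).
  have : 0 <= Num.min (z ^+ 2 * n%:R) nd by rewrite le_min nd0 mulr_ge0// sqr_ge0.
  by move=> /(mulr_ge0 (ltW e0)); rewrite -/nd; lra.
move: HT HN HE; rewrite -/nd.
set T := z ^+ 2 * rate_min _ _ _; set N := z ^+ 2 * n%:R => HT HN HE.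
have c0 : 0 <= expR (- 4) / 160 / 160 :> R by lra.
move: (expR _ / _ / _) c0 HT HN HE => c c0 HT HN HE.
have [t [H tT tN tE]] : exists t, [/\ ((c * t)%:E <= minimax_risk n d lam zeta)%E,
    Num.min T nd <= t, Num.min N nd <= t & Num.min E nd <= t].
  have [TN|/ltW NT] := leP (Num.min T nd) (Num.min N nd).
    have [NE|/ltW EN] := leP (Num.min N nd) (Num.min E nd).
      by exists (Num.min E nd); split => //; exact: le_trans NE.
    by exists (Num.min N nd).
  have [TE|/ltW ET] := leP (Num.min T nd) (Num.min E nd).
    by exists (Num.min E nd); split => //; exact: le_trans TE.
  by exists (Num.min T nd).
apply: risk_ge_le H; rewrite -mulrA ler_wpM2l//.
have t0 : 0 <= t by apply: le_trans tE.
rewrite ler_pdivrMl//; move: tT tN tE; rewrite !ge_min => tT tN tE.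
have [ndt|tnd] := leP nd t; first by apply/orP; right; lra.
by move: tT tN tE; rewrite !(leNgt nd) tnd !orbF => tT tN tE; apply/orP; left; lra.
Qed.
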